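(* Let $\mathcal{C}$ be a $\mathbb{C}$-linear pivotal dagger 2-category with split dagger idempotents. Let $s,t$ be simple objects, and let $X:r\to s$ and $Y:r\to t$ be 1-morphisms with $\dim_L(X)=d_X\,\mathrm{id}$ and $\dim_L(Y)=d_Y\,\mathrm{id}$, where $d_X,d_Y>0$. Then $X$ and $Y$ are equivalent in $\mathcal{C}$ if and only if the special Frobenius monoids $X\otimes X^*$ and $Y\otimes Y^*$ in $\mathrm{End}(r)$ are unitarily $*$-isomorphic.
   Context: All 2-categories are taken to be strict. 1-morphisms compose from left to right: for $X:r\to s$ and $Y:s\to t$ the composite is $X\otimes Y:r\to t$; $\otimes$ also denotes horizontal composition of 2-morphisms, and $\circ$ vertical composition. Pivotal dagger 2-categories. A right dual of $X:r\to s$ is $[X^*,\eta_X,\epsilon_X]$ with $X^*:s\to r$, $\eta_X:\mathrm{id}_s\to X^*\otimes X$, $\epsilon_X:X\otimes X^*\to\mathrm{id}_r$ satisfying the snake equations. A 2-category with chosen right duals is pivotal if it is equipped with 2-isomorphisms $\iota_X:X^{**}\to X$, natural in $X$ (with respect to double transposition of 2-morphisms) and compatible with composition and identities via the canonical isomorphisms from uniqueness of duals; then $X^*$ is also a left dual of $X$ with cup $(\iota_X\otimes\mathrm{id}_{X^*})\circ\eta_{X^*}:\mathrm{id}_r\to X\otimes X^*$ and cap $\epsilon_{X^*}\circ(\mathrm{id}_{X^*}\otimes\iota_X^{-1}):X^*\otimes X\to\mathrm{id}_s$. A dagger 2-category is a 2-category with contravariant identity-on-objects involutive functors $\dagger$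 on each hom-category such that $(\alpha\otimes\beta)^\dagger=\alpha^\dagger\otimes\beta^\dagger$. A pivotal dagger 2-category is a pivotal and dagger 2-category such that the left cup and cap of every $X$ equal $\epsilon_X^\dagger$ and $\eta_X^\dagger$ respectively. A 2-morphism $f:X\to Y$ is an isometry if $f^\dagger\circ f=\mathrm{id}_X$, and unitary if moreover $f\circ f^\dagger=\mathrm{id}_Y$. $\mathbb{C}$-linear: the 2-morphism sets are complex vector spaces, horizontal and vertical composition are bilinear, the dagger is antilinear, and (standing assumption) for any 2-morphism $f$, $f^\dagger\circ f=0$ implies $f=0$. An object $r$ is simple if $\mathrm{Hom}(\mathrm{id}_r,\mathrm{id}_r)\cong\mathbb{C}$. The left dimension of $X:r\to s$ is $\dim_L(X)=\eta_X^\dagger\circ\eta_X:\mathrm{id}_s\to\mathrm{id}_s$; when $s$ is simple, $\dim_L(X)=d_X\,\mathrm{id}_{\mathrm{id}_s}$ for a scalar $d_X$. Split dagger idempotents: for any $X:r\to s$ and $\alpha:X\to X$ with $\alpha=\alpha^\dagger=\alpha\circ\alpha$ there exist a 1-morphism $V:r\to s$ and an isometry $i:V\to X$ with $i\circ i^\dagger=\alpha$. A dagger equivalence is a 1-morphism $E:t\to s$ for which there exist $E^{-1}:s\to t$ and unitary 2-morphisms $\mathrm{id}_s\to E^{-1}\otimes E$ and $E\otimes E^{-1}\to\mathrm{id}_t$. Two 1-morphisms $X:r\to s$ and $Y:r\to t$ are equivalent if there exist a dagger equivalence $E:t\to s$ and a unitary 2-morphism $\tau:X\to Y\otimes E$.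 $\mathrm{End}(r)=\mathrm{Hom}(r,r)$ is a monoidal dagger category. In a monoidal dagger category, a monoid $(A,m:A\otimes A\to A,u:\mathbb{1}\to A)$ (associative, unital) is Frobenius if $(m\otimes\mathrm{id})\circ(\mathrm{id}\otimes m^\dagger)=m^\dagger\circ m=(\mathrm{id}\otimes m)\circ(m^\dagger\otimes\mathrm{id})$, and special if $m\circ m^\dagger=\mathrm{id}_A$. A $*$-homomorphism $f:A\to B$ of Frobenius monoids is a morphism with $f\circ m_A=m_B\circ(f\otimes f)$, $f\circ u_A=u_B$ and $f^\dagger=(\mathrm{id}_A\otimes(u_B^\dagger\circ m_B))\circ(\mathrm{id}_A\otimes f\otimes\mathrm{id}_B)\circ((m_A^\dagger\circ u_A)\otimes\mathrm{id}_B)$. A unitary $*$-isomorphism is a unitary $*$-homomorphism; $A,B$ are unitarily $*$-isomorphic if one exists. For $X:r\to s$ with $s$ simple and $d_X>0$, the object $X\otimes X^*$ of $\mathrm{End}(r)$ is a special Frobenius monoid with multiplication $\frac{1}{\sqrt{d_X}}\,(\mathrm{id}_X\otimes\eta_X^\dagger\otimes\mathrm{id}_{X^*})$ and unit $\sqrt{d_X}\,\epsilon_X^\dagger:\mathrm{id}_r\to X\otimes X^*$. *)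

(* Defs.v *)
From mathcomp Require Import all_boot all_order all_algebra.
From mathcomp Require Import boolp.

Set Implicit Arguments.
Unset Strict Implicit.
Unset Printing Implicit Defensive.

Import Order.TTheory GRing.Theory Num.Theory.
Local Open Scope ring_scope.

Reserved Notation "X ⊗ Y" (at level 38, left associativity).
Reserved Notation "f ⊠ g" (at level 38, left associativity).
Reserved Notation "g ∘ f" (at level 45, left associativity).

Record category := Category {
  ob :> Type;
  hom1 : ob -> ob -> Type;
  id1 : forall r, hom1 r r;
  (* diagrammatic order *)
  comp1 : forall r s t, hom1 r s -> hom1 s t -> hom1 r t;
  comp1A : forall r s t u (X : hom1 r s) (Y : hom1 s t) (Z : hom1 t u),
    comp1 X (comp1 Y Z) = comp1 (comp1 X Y) Z;
  comp1_1l : forall r s (X : hom1 r s), comp1 (id1 r) X = X;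
  comp1_1r : forall r s (X : hom1 r s), comp1 X (id1 s) = X
}.

Arguments id1 {c} r.
Arguments comp1A {c r s t u} X Y Z.
Arguments comp1_1l {c r s} X.
Arguments comp1_1r {c r s} X.

Notation "X ⊗ Y" := (comp1 X Y).

(* [comp2] is vertical composition, in the usual (right-to-left) order;
   [tens2] is horizontal composition, in diagrammatic order. *)
Record pre_2category (K : pzRingType) := Pre2Category {
  underlying :> category;
  hom2 : forall r s : underlying, hom1 r s -> hom1 r s -> lmodType K;
  id2 : forall (r s : underlying) (X : hom1 r s), hom2 X X;
  comp2 : forall (r s : underlying) (X Y Z : hom1 r s),
    hom2 Y Z -> hom2 X Y -> hom2 X Z;
  tens2 : forall (r s t : underlying) (X X' : hom1 r s) (Y Y' : hom1 s t),
    hom2 X X' -> hom2 Y Y' -> hom2 (X ⊗ Y) (X' ⊗ Y')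
}.

Arguments hom2 {K p r s} X Y.
Arguments id2 {K p r s} X.

Notation "g ∘ f" := (comp2 g f).
Notation "f ⊠ g" := (tens2 f g).

(* Composition of 1-morphisms is strictly associative and unital, but only up
   to propositional equality, so that e.g. [X ⊗ (Y ⊗ Z)] and [(X ⊗ Y) ⊗ Z] are
   not the same type index. The 2-morphisms below are identities transported
   along these equalities; they are silent in the usual notation. *)
Section IdentityCells.
Variables (K : pzRingType) (C : pre_2category K).

Definition idto (r s : C) (X Y : hom1 r s) (p : X = Y) : hom2 X Y :=
  match p in _ = Y return hom2 X Y with erefl => id2 X end.

Definition asc (r s t u : C) (X : hom1 r s) (Y : hom1 s t) (Z : hom1 t u) :
  hom2 (X ⊗ (Y ⊗ Z)) ((X ⊗ Y) ⊗ Z) := idto (comp1A X Y Z).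
Definition ascV (r s t u : C) (X : hom1 r s) (Y : hom1 s t) (Z : hom1 t u) :
  hom2 ((X ⊗ Y) ⊗ Z) (X ⊗ (Y ⊗ Z)) := idto (esym (comp1A X Y Z)).
Definition lun (r s : C) (X : hom1 r s) : hom2 (id1 r ⊗ X) X :=
  idto (comp1_1l X).
Definition lunV (r s : C) (X : hom1 r s) : hom2 X (id1 r ⊗ X) :=
  idto (esym (comp1_1l X)).
Definition run (r s : C) (X : hom1 r s) : hom2 (X ⊗ id1 s) X :=
  idto (comp1_1r X).
Definition runV (r s : C) (X : hom1 r s) : hom2 X (X ⊗ id1 s) :=
  idto (esym (comp1_1r X)).

End IdentityCells.

Record linear_2category_axioms (K : pzRingType) (C : pre_2category K) : Prop :=
  Linear2CategoryAxioms {
  comp2A : forall (r s : C) (W X Y Z : hom1 r s)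
    (h : hom2 Y Z) (g : hom2 X Y) (f : hom2 W X), h ∘ (g ∘ f) = h ∘ g ∘ f;
  comp2_1l : forall (r s : C) (X Y : hom1 r s) (f : hom2 X Y), id2 Y ∘ f = f;
  comp2_1r : forall (r s : C) (X Y : hom1 r s) (f : hom2 X Y), f ∘ id2 X = f;
  tens2_id : forall (r s t : C) (X : hom1 r s) (Y : hom1 s t),
    id2 X ⊠ id2 Y = id2 (X ⊗ Y);
  interchange : forall (r s t : C) (X X' X'' : hom1 r s) (Y Y' Y'' : hom1 s t)
    (f : hom2 X X') (f' : hom2 X' X'') (g : hom2 Y Y') (g' : hom2 Y' Y''),
    (f' ∘ f) ⊠ (g' ∘ g) = (f' ⊠ g') ∘ (f ⊠ g);
  tens2A : forall (r s t u : C) (X X' : hom1 r s) (Y Y' : hom1 s t)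
    (Z Z' : hom1 t u) (f : hom2 X X') (g : hom2 Y Y') (h : hom2 Z Z'),
    asc X' Y' Z' ∘ (f ⊠ (g ⊠ h)) = ((f ⊠ g) ⊠ h) ∘ asc X Y Z;
  tens2_1l : forall (r s : C) (X Y : hom1 r s) (f : hom2 X Y),
    lun Y ∘ (id2 (id1 r) ⊠ f) = f ∘ lun X;
  tens2_1r : forall (r s : C) (X Y : hom1 r s) (f : hom2 X Y),
    run Y ∘ (f ⊠ id2 (id1 s)) = f ∘ run X;
  comp2_linearl : forall (r s : C) (X Y Z : hom1 r s) (f : hom2 X Y),
    linear (fun g : hom2 Y Z => g ∘ f);
  comp2_linearr : forall (r s : C) (X Y Z : hom1 r s) (g : hom2 Y Z),
    linear (fun f : hom2 X Y => g ∘ f);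
  tens2_linearl : forall (r s t : C) (X X' : hom1 r s) (Y Y' : hom1 s t)
    (g : hom2 Y Y'), linear (fun f : hom2 X X' => f ⊠ g);
  tens2_linearr : forall (r s t : C) (X X' : hom1 r s) (Y Y' : hom1 s t)
    (f : hom2 X X'), linear (fun g : hom2 Y Y' => f ⊠ g)
}.

Record linear_2category (K : pzRingType) := Linear2Category {
  pre2cat :> pre_2category K;
  lin2catP : linear_2category_axioms pre2cat
}.

(* 2-morphisms bundled with their boundary: [Cell f = Cell g] is equality up to
   the identity cells [idto]. *)
Section Cells.
Variables (K : pzRingType) (C : linear_2category K).
Let ax := lin2catP C.

Definition cell (r s : C) := {X : hom1 r s & {Y : hom1 r s & hom2 X Y}}.

Definition Cell (r s : C) (X Y : hom1 r s) (f : hom2 X Y) : cell r s :=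
  existT _ X (existT _ Y f).

Definition ctens (r s t : C) (a : cell r s) (b : cell s t) : cell r t :=
  Cell (projT2 (projT2 a) ⊠ projT2 (projT2 b)).

Lemma CellP (r s : C) (X Y X' Y' : hom1 r s) (f : hom2 X Y) (f' : hom2 X' Y') :
  Cell f = Cell f' <->
  exists (p : X = X') (q : Y = Y'), idto q ∘ f = f' ∘ idto p.
Proof.
split=> [E|[p [q]]].
  pose P (c : cell r s) := exists (p : X = projT1 c) (q : Y = projT1 (projT2 c)),
    idto q ∘ f = projT2 (projT2 c) ∘ idto p.
  suff: P (Cell f') by [].
  by rewrite -E; exists erefl, erefl; rewrite /= (comp2_1l ax) (comp2_1r ax).
by destruct p, q; rewrite /= (comp2_1l ax) (comp2_1r ax) => ->.
Qed.

Lemma Cell_inj (r s : C) (X Y : hom1 r s) (f f' : hom2 X Y) :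
  Cell f = Cell f' -> f = f'.
Proof.
case/CellP => p [q]; rewrite (Prop_irrelevance p erefl) (Prop_irrelevance q erefl) /=.
by rewrite (comp2_1l ax) (comp2_1r ax).
Qed.

Lemma Cell_comp (r s : C) (X Y Z X' Y' Z' : hom1 r s)
  (g : hom2 Y Z) (f : hom2 X Y) (g' : hom2 Y' Z') (f' : hom2 X' Y') :
  Cell g = Cell g' -> Cell f = Cell f' -> Cell (g ∘ f) = Cell (g' ∘ f').
Proof.
case/CellP => p [q]; destruct p, q; rewrite /= (comp2_1l ax) (comp2_1r ax) => ->.
case/CellP => p [q]; destruct p; rewrite (Prop_irrelevance q erefl) /=.
by rewrite (comp2_1l ax) (comp2_1r ax) => ->.
Qed.

Lemma Cell_scale (r s : C) (X Y X' Y' : hom1 r s) (k : K)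
  (f : hom2 X Y) (f' : hom2 X' Y') :
  Cell f = Cell f' -> Cell (k *: f) = Cell (k *: f').
Proof.
case/CellP => p [q]; destruct p, q.
by rewrite /= (comp2_1l ax) (comp2_1r ax) => ->.
Qed.

Lemma Cell_id (r s : C) (X Y : hom1 r s) :
  X = Y -> Cell (id2 X) = Cell (id2 Y).
Proof. by move->. Qed.

Lemma Cell_idtol (r s : C) (X Y Z : hom1 r s) (p : Y = Z) (f : hom2 X Y) :
  Cell (idto p ∘ f) = Cell f.
Proof. by destruct p; rewrite /= (comp2_1l ax). Qed.

Lemma Cell_idtor (r s : C) (X Y Z : hom1 r s) (p : X = Y) (f : hom2 Y Z) :
  Cell (f ∘ idto p) = Cell f.
Proof. by destruct p; rewrite /= (comp2_1r ax). Qed.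

Lemma Cell_idto (r s : C) (X Y : hom1 r s) (p : X = Y) :
  Cell (idto p) = Cell (id2 X).
Proof. by destruct p. Qed.

Lemma Cell_idl (r s : C) (X Y Z W : hom1 r s) (g : hom2 Y Z) (f : hom2 X Y) :
  Cell g = Cell (id2 W) -> Cell (g ∘ f) = Cell f.
Proof.
move=> gE; rewrite -[f in RHS](comp2_1l ax); apply: Cell_comp => //.
rewrite gE; apply: Cell_id.
by case/CellP: gE => p _; rewrite p.
Qed.

Lemma Cell_idr (r s : C) (X Y Z W : hom1 r s) (g : hom2 Y Z) (f : hom2 X Y) :
  Cell f = Cell (id2 W) -> Cell (g ∘ f) = Cell g.
Proof.
move=> fE; rewrite -[g in RHS](comp2_1r ax); apply: Cell_comp => //.
rewrite fE; apply: Cell_id.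
by case/CellP: fE => _ [q _]; rewrite q.
Qed.

Lemma Cell_split (r s : C) (X Z X' Y' Z' : hom1 r s)
  (h : hom2 X Z) (g : hom2 Y' Z') (f : hom2 X' Y') :
  Cell h = Cell (g ∘ f) ->
  exists (g' : hom2 Y' Z) (f' : hom2 X Y'),
    [/\ h = g' ∘ f', Cell g' = Cell g & Cell f' = Cell f].
Proof.
case/CellP => p [q]; destruct p, q; rewrite /= (comp2_1l ax) (comp2_1r ax) => ->.
by exists g, f.
Qed.

Lemma Cell_tens (r s t : C) (X Y : hom1 r s) (Z W : hom1 s t)
  (f : hom2 X Y) (g : hom2 Z W) : Cell (f ⊠ g) = ctens (Cell f) (Cell g).
Proof. by []. Qed.

Lemma ctensA (r s t u : C) (a : cell r s) (b : cell s t) (c : cell t u) :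
  ctens a (ctens b c) = ctens (ctens a b) c.
Proof.
apply/CellP; exists (comp1A _ _ _), (comp1A _ _ _); exact: (tens2A ax).
Qed.

Lemma ctens1l (r s : C) (a : cell r s) : ctens (Cell (id2 (id1 r))) a = a.
Proof.
case: a => X [Y f]; apply/CellP; exists (comp1_1l _), (comp1_1l _).
exact: (tens2_1l ax).
Qed.

Lemma ctens1r (r s : C) (a : cell r s) : ctens a (Cell (id2 (id1 s))) = a.
Proof.
case: a => X [Y f]; apply/CellP; exists (comp1_1r _), (comp1_1r _).
exact: (tens2_1r ax).
Qed.

Lemma whiskerl (r s t : C) (X : hom1 r s) (Y Y' Y'' : hom1 s t)
  (g : hom2 Y' Y'') (f : hom2 Y Y') :
  id2 X ⊠ (g ∘ f) = (id2 X ⊠ g) ∘ (id2 X ⊠ f).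
Proof. by rewrite -(interchange ax) (comp2_1l ax). Qed.

Lemma whiskerr (r s t : C) (X : hom1 s t) (Y Y' Y'' : hom1 r s)
  (g : hom2 Y' Y'') (f : hom2 Y Y') :
  (g ∘ f) ⊠ id2 X = (g ⊠ id2 X) ∘ (f ⊠ id2 X).
Proof. by rewrite -(interchange ax) (comp2_1l ax). Qed.

Lemma slidel (r s t : C) (X X' : hom1 r s) (Y Y' : hom1 s t)
  (f : hom2 X X') (g : hom2 Y Y') : (f ⊠ id2 Y') ∘ (id2 X ⊠ g) = f ⊠ g.
Proof. by rewrite -(interchange ax) (comp2_1l ax) (comp2_1r ax). Qed.

Lemma slider (r s t : C) (X X' : hom1 r s) (Y Y' : hom1 s t)
  (f : hom2 X X') (g : hom2 Y Y') : (id2 X' ⊠ g) ∘ (f ⊠ id2 Y) = f ⊠ g.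
Proof. by rewrite -(interchange ax) (comp2_1l ax) (comp2_1r ax). Qed.

Definition cellE := (Cell_tens, Cell_idtol, Cell_idtor, ctensA, ctens1l, ctens1r).

End Cells.

Record right_dual (K : pzRingType) (C : pre_2category K) (r s : C)
    (X : hom1 r s) := RightDual {
  dual_ob :> hom1 s r;
  cup : hom2 (id1 s) (dual_ob ⊗ X);
  cap : hom2 (X ⊗ dual_ob) (id1 r);
  snakel : lun X ∘ (cap ⊠ id2 X) ∘ asc X dual_ob X ∘ (id2 X ⊠ cup) ∘ runV X
           = id2 X;
  snaker : run dual_ob ∘ (id2 dual_ob ⊠ cap) ∘ ascV dual_ob X dual_ob
           ∘ (cup ⊠ id2 dual_ob) ∘ lunV dual_ob = id2 dual_ob
}.

Arguments RightDual {K C r s X}.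

Section Duals.
Variables (K : pzRingType) (C : linear_2category K).
Let ax := lin2catP C.

Definition dual_iso (r s : C) (X : hom1 r s) (D D' : right_dual X) :
  hom2 D D' :=
  run D' ∘ (id2 D' ⊠ cap D) ∘ ascV D' X D ∘ (cup D' ⊠ id2 D) ∘ lunV D.

Definition transpose (r s : C) (X Y : hom1 r s) (DX : right_dual X)
    (DY : right_dual Y) (f : hom2 X Y) : hom2 DY DX :=
  run DX ∘ (id2 DX ⊠ cap DY) ∘ ascV DX Y DY ∘ ((id2 DX ⊠ f) ⊠ id2 DY)
  ∘ (cup DX ⊠ id2 DY) ∘ lunV DY.

Lemma snakel_cell (r s : C) (X : hom1 r s) (D : right_dual X)
  (P Q R : hom1 r s) (f : hom2 Q R) (g : hom2 P Q) :
  Cell f = Cell (cap D ⊠ id2 X) -> Cell g = Cell (id2 X ⊠ cup D) ->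
  Cell (f ∘ g) = Cell (id2 X).
Proof.
move=> fE gE; rewrite -[in RHS](snakel D) Cell_idtor; apply: Cell_comp => //.
by rewrite Cell_idtor Cell_idtol.
Qed.

Lemma snaker_cell (r s : C) (X : hom1 r s) (D : right_dual X)
  (P Q R : hom1 s r) (f : hom2 Q R) (g : hom2 P Q) :
  Cell f = Cell (id2 D ⊠ cap D) -> Cell g = Cell (cup D ⊠ id2 D) ->
  Cell (f ∘ g) = Cell (id2 D).
Proof.
move=> fE gE; rewrite -[in RHS](snaker D) Cell_idtor; apply: Cell_comp => //.
by rewrite Cell_idtor Cell_idtol.
Qed.

Section Identity.
Variable r : C.

Lemma id_snakel :
  lun (id1 r) ∘ (lun (id1 r) ⊠ id2 (id1 r)) ∘ asc (id1 r) (id1 r) (id1 r)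
  ∘ (id2 (id1 r) ⊠ lunV (id1 r)) ∘ runV (id1 r) = id2 (id1 r).
Proof.
apply: Cell_inj; rewrite Cell_idtor.
rewrite (@Cell_idr _ _ _ _ _ _ _ (id1 r)) ?Cell_idtor ?Cell_idtol.
all: by rewrite Cell_tens ?ctens1l ?ctens1r Cell_idto ?(Cell_id (comp1_1l _)).
Qed.

Lemma id_snaker :
  run (id1 r) ∘ (id2 (id1 r) ⊠ lun (id1 r)) ∘ ascV (id1 r) (id1 r) (id1 r)
  ∘ (lunV (id1 r) ⊠ id2 (id1 r)) ∘ lunV (id1 r) = id2 (id1 r).
Proof.
apply: Cell_inj; rewrite Cell_idtor.
rewrite (@Cell_idr _ _ _ _ _ _ _ (id1 r)) ?Cell_idtor ?Cell_idtol.
  by rewrite Cell_tens ?ctens1l ?ctens1r Cell_idto ?(Cell_id (comp1_1l _)).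
by rewrite Cell_tens ?ctens1l ?ctens1r Cell_idto ?(Cell_id (comp1_1l _)).
Qed.

Definition id_dual : right_dual (id1 r) :=
  RightDual (id1 r) (lunV (id1 r)) (lun (id1 r)) id_snakel id_snaker.

End Identity.

Section Composite.
Variables (r s t : C) (X : hom1 r s) (Y : hom1 s t).
Variables (DX : right_dual X) (DY : right_dual Y).

Definition comp_cup : hom2 (id1 t) ((DY ⊗ DX) ⊗ (X ⊗ Y)) :=
  asc DY DX (X ⊗ Y) ∘ (id2 DY ⊠ (ascV DX X Y ∘ (cup DX ⊠ id2 Y) ∘ lunV Y))
  ∘ cup DY.

Definition comp_cap : hom2 ((X ⊗ Y) ⊗ (DY ⊗ DX)) (id1 r) :=
  cap DX ∘ (id2 X ⊠ (lun DX ∘ (cap DY ⊠ id2 DX) ∘ asc Y DY DX))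
  ∘ ascV X Y (DY ⊗ DX).

Lemma comp_snakel :
  lun (X ⊗ Y) ∘ (comp_cap ⊠ id2 (X ⊗ Y)) ∘ asc (X ⊗ Y) (DY ⊗ DX) (X ⊗ Y)
  ∘ (id2 (X ⊗ Y) ⊠ comp_cup) ∘ runV (X ⊗ Y) = id2 (X ⊗ Y).
Proof.
apply: Cell_inj; rewrite Cell_idtor.
have capE : Cell (comp_cap ⊠ id2 (X ⊗ Y)) =
    Cell ((cap DX ⊠ id2 X ⊠ id2 Y)
          ∘ (id2 X ⊠ (lun DX ∘ (cap DY ⊠ id2 DX)) ⊠ id2 X ⊠ id2 Y)).
  rewrite /comp_cap -(comp2A ax) (whiskerr (X ⊗ Y)) -!(tens2_id ax).
  by apply: Cell_comp; rewrite !cellE.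
have cupE : Cell (id2 (X ⊗ Y) ⊠ comp_cup) =
    Cell ((id2 X ⊠ id2 Y ⊠ (id2 DY ⊠ ((cup DX ⊠ id2 Y) ∘ lunV Y)))
          ∘ (id2 X ⊠ id2 Y ⊠ cup DY)).
  rewrite /comp_cup (whiskerl (X ⊗ Y)) -!(tens2_id ax).
  by apply: Cell_comp; rewrite !cellE.
have [c1 [c2 [-> c1E c2E]]] := Cell_split capE.
have [d1 [d2 [-> d1E d2E]]] := Cell_split cupE.
have midE : Cell (c2 ∘ asc (X ⊗ Y) (DY ⊗ DX) (X ⊗ Y) ∘ d1) =
  Cell (((id2 X ⊠ cup DX ∘ runV X) ⊠ id2 Y)
        ∘ (id2 X ⊠ (lun Y ∘ (cap DY ⊠ id2 Y)))).
  transitivity (Cell (id2 X ⊠ (cap DY ⊠ cup DX) ⊠ id2 Y)).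
    rewrite -(slidel (cap DY)) whiskerl whiskerr; apply: Cell_comp.
      by rewrite Cell_idtor c2E -!(tens2_id ax) !cellE.
    by rewrite d1E -!(tens2_id ax) !cellE.
  rewrite -(slider (cap DY)) whiskerl whiskerr.
  by apply: Cell_comp; rewrite !cellE.
have [e1 [e2 [midE' e1E e2E]]] := Cell_split midE.
have -> : lun (X ⊗ Y) ∘ (c1 ∘ c2) ∘ asc (X ⊗ Y) (DY ⊗ DX) (X ⊗ Y) ∘ (d1 ∘ d2)
    = lun (X ⊗ Y) ∘ (c1 ∘ e1) ∘ (e2 ∘ d2).
  by rewrite !(comp2A ax) -(comp2A ax _ e1) -midE' !(comp2A ax).
rewrite -[in RHS](tens2_id ax) -[RHS](Cell_idl (W := X ⊗ Y)
  (g := id2 (X ⊗ Y)) _ erefl).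
apply: Cell_comp.
  rewrite Cell_idtol -(tens2_id ax) Cell_tens.
  rewrite -(snakel DX) Cell_idtor -(comp2A ax) -(comp2A ax) Cell_idtol.
  rewrite -Cell_tens whiskerr; apply: Cell_comp.
    by rewrite c1E.
  by rewrite e1E !Cell_tens Cell_idtor Cell_idtol.
rewrite Cell_tens -(snakel DY) Cell_idtor -(comp2A ax).
rewrite -Cell_tens whiskerl; apply: Cell_comp.
  by rewrite e2E.
by rewrite d2E !Cell_tens Cell_idtol !Cell_tens !ctensA.
Qed.

Lemma comp_snaker :
  run (DY ⊗ DX) ∘ (id2 (DY ⊗ DX) ⊠ comp_cap)
  ∘ ascV (DY ⊗ DX) (X ⊗ Y) (DY ⊗ DX) ∘ (comp_cup ⊠ id2 (DY ⊗ DX))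
  ∘ lunV (DY ⊗ DX) = id2 (DY ⊗ DX).
Proof.
apply: Cell_inj; rewrite Cell_idtor.
have capE : Cell (id2 (DY ⊗ DX) ⊠ comp_cap) =
    Cell ((id2 DY ⊠ id2 DX ⊠ cap DX)
          ∘ (id2 DY ⊠ id2 DX ⊠ (id2 X ⊠ (lun DX ∘ (cap DY ⊠ id2 DX))))).
  rewrite /comp_cap -(comp2A ax) (whiskerl (DY ⊗ DX)) -!(tens2_id ax).
  by apply: Cell_comp; rewrite !cellE.
have cupE : Cell (comp_cup ⊠ id2 (DY ⊗ DX)) =
    Cell (((id2 DY ⊠ ((cup DX ⊠ id2 Y) ∘ lunV Y)) ⊠ id2 DY ⊠ id2 DX)
          ∘ (cup DY ⊠ id2 DY ⊠ id2 DX)).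
  rewrite /comp_cup (whiskerr (DY ⊗ DX)) -!(tens2_id ax).
  by apply: Cell_comp; rewrite !cellE.
have [c1 [c2 [-> c1E c2E]]] := Cell_split capE.
have [d1 [d2 [-> d1E d2E]]] := Cell_split cupE.
have midE : Cell (c2 ∘ ascV (DY ⊗ DX) (X ⊗ Y) (DY ⊗ DX) ∘ d1) =
  Cell ((id2 DY ⊠ ((cup DX ⊠ id2 DX) ∘ lunV DX))
        ∘ ((run DY ∘ (id2 DY ⊠ cap DY)) ⊠ id2 DX)).
  transitivity (Cell (id2 DY ⊠ (cup DX ⊠ cap DY) ⊠ id2 DX)).
    rewrite -(slider (cup DX)) whiskerl whiskerr; apply: Cell_comp.
      by rewrite Cell_idtor c2E -!(tens2_id ax) !cellE.
    by rewrite d1E -!(tens2_id ax) !cellE.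
  rewrite -(slidel (cup DX)) whiskerl whiskerr.
  by apply: Cell_comp; rewrite !cellE.
have [e1 [e2 [midE' e1E e2E]]] := Cell_split midE.
have -> : run (DY ⊗ DX) ∘ (c1 ∘ c2) ∘ ascV (DY ⊗ DX) (X ⊗ Y) (DY ⊗ DX)
      ∘ (d1 ∘ d2)
    = run (DY ⊗ DX) ∘ (c1 ∘ e1) ∘ (e2 ∘ d2).
  by rewrite !(comp2A ax) -(comp2A ax _ e1) -midE' !(comp2A ax).
rewrite -[in RHS](tens2_id ax) -[RHS](Cell_idl (W := DY ⊗ DX)
  (g := id2 (DY ⊗ DX)) _ erefl).
apply: Cell_comp.
  rewrite Cell_idtol -(tens2_id ax) Cell_tens.
  rewrite -(snaker DX) Cell_idtor -(comp2A ax) -(comp2A ax) Cell_idtol.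
  rewrite -Cell_tens whiskerl; apply: Cell_comp.
    by rewrite c1E !cellE.
  by rewrite e1E !cellE.
rewrite Cell_tens -(snaker DY) Cell_idtor -(comp2A ax).
rewrite -Cell_tens whiskerr; apply: Cell_comp.
  by rewrite e2E !cellE.
by rewrite d2E !cellE.
Qed.

Definition comp_dual : right_dual (X ⊗ Y) :=
  RightDual (DY ⊗ DX) comp_cup comp_cap comp_snakel comp_snaker.

End Composite.
End Duals.

(* [dagger] is contravariant and the identity on objects of each hom-category. *)
Record dagger_2category (K : numClosedFieldType) := Dagger2Category {
  lin2cat :> linear_2category K;
  dag : forall (r s : lin2cat) (X Y : hom1 r s), hom2 X Y -> hom2 Y X;
  dagK : forall (r s : lin2cat) (X Y : hom1 r s) (f : hom2 X Y),
    dag (dag f) = f;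
  dag_id : forall (r s : lin2cat) (X : hom1 r s), dag (id2 X) = id2 X;
  dag_comp : forall (r s : lin2cat) (X Y Z : hom1 r s)
    (g : hom2 Y Z) (f : hom2 X Y), dag (g ∘ f) = dag f ∘ dag g;
  dag_tens : forall (r s t : lin2cat) (X X' : hom1 r s) (Y Y' : hom1 s t)
    (f : hom2 X X') (g : hom2 Y Y'), dag (f ⊠ g) = dag f ⊠ dag g;
  dag_antilinear : forall (r s : lin2cat) (X Y : hom1 r s) (k : K)
    (f g : hom2 X Y), dag (k *: f + g) = k^* *: dag f + dag g;
  dag_definite : forall (r s : lin2cat) (X Y : hom1 r s) (f : hom2 X Y),
    dag f ∘ f = 0 -> f = 0
}.

Arguments dag {K d r s X Y} f.

Notation "f ^†" := (dag f) (at level 2, left associativity, format "f ^†").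

Record pivotal_structure (K : pzRingType) (C : linear_2category K) :=
  PivotalStructure {
  rdual : forall (r s : C) (X : hom1 r s), right_dual X;
  iota : forall (r s : C) (X : hom1 r s), hom2 (rdual (rdual X)) X;
  iotaV : forall (r s : C) (X : hom1 r s), hom2 X (rdual (rdual X));
  iotaK : forall (r s : C) (X : hom1 r s), iotaV X ∘ iota X = id2 _;
  iotaVK : forall (r s : C) (X : hom1 r s), iota X ∘ iotaV X = id2 X;
  iota_natural : forall (r s : C) (X Y : hom1 r s) (f : hom2 X Y),
    iota Y ∘ transpose (rdual (rdual Y)) (rdual (rdual X))
               (transpose (rdual X) (rdual Y) f)
    = f ∘ iota X;
  (* Writing D for [rdual], the right-hand side is the composite
     D (D (X ⊗ Y)) -> D (D Y ⊗ D X) -> D (D X) ⊗ D (D Y) -> X ⊗ Y, whose first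
     map is the transpose of the canonical map D Y ⊗ D X -> D (X ⊗ Y). *)
  iota_comp : forall (r s t : C) (X : hom1 r s) (Y : hom1 s t),
    iota (X ⊗ Y)
    = (iota X ⊠ iota Y)
      ∘ dual_iso (rdual (rdual Y ⊗ rdual X))
          (comp_dual (rdual (rdual Y)) (rdual (rdual X)))
      ∘ transpose (rdual (rdual Y ⊗ rdual X)) (rdual (rdual (X ⊗ Y)))
          (dual_iso (comp_dual (rdual X) (rdual Y)) (rdual (X ⊗ Y)));
  iota_id : forall r : C,
    iota (id1 r)
    = dual_iso (rdual (id1 r)) (id_dual r)
      ∘ transpose (rdual (id1 r)) (rdual (rdual (id1 r)))
          (dual_iso (id_dual r) (rdual (id1 r)))
}.

Record pivotal_dagger_2category (K : numClosedFieldType) :=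
  PivotalDagger2Category {
  dag2cat :> dagger_2category K;
  pivotal : pivotal_structure dag2cat;
  left_cupE : forall (r s : dag2cat) (X : hom1 r s),
    (iota pivotal X ⊠ id2 (rdual pivotal X)) ∘ cup (rdual pivotal (rdual pivotal X))
    = (cap (rdual pivotal X))^†;
  left_capE : forall (r s : dag2cat) (X : hom1 r s),
    cap (rdual pivotal (rdual pivotal X)) ∘ (id2 (rdual pivotal X) ⊠ iotaV pivotal X)
    = (cup (rdual pivotal X))^†
}.

Definition chosen_dual (K : numClosedFieldType) (C : pivotal_dagger_2category K)
  (r s : C) (X : hom1 r s) : right_dual X := rdual (pivotal C) X.

Section Notions.
Variables (K : numClosedFieldType) (C : pivotal_dagger_2category K).

Definition isometry (r s : C) (X Y : hom1 r s) (f : hom2 X Y) : Prop :=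
  f^† ∘ f = id2 X.

Definition unitary (r s : C) (X Y : hom1 r s) (f : hom2 X Y) : Prop :=
  isometry f /\ f ∘ f^† = id2 Y.

Definition dimL (r s : C) (X : hom1 r s) : hom2 (id1 s) (id1 s) :=
  (cup (chosen_dual X))^† ∘ cup (chosen_dual X).

Definition simple_ob (r : C) : Prop :=
  exists f : {linear hom2 (id1 r) (id1 r) -> K^o}, bijective f.

Definition split_dagger_idempotents : Prop :=
  forall (r s : C) (X : hom1 r s) (a : hom2 X X),
  a = a^† -> a = a ∘ a ->
  exists (V : hom1 r s) (i : hom2 V X), isometry i /\ i ∘ i^† = a.

Definition dagger_equivalence (t s : C) (E : hom1 t s) : Prop :=
  exists (E' : hom1 s t) (f : hom2 (id1 s) (E' ⊗ E))
    (g : hom2 (E ⊗ E') (id1 t)), unitary f /\ unitary g.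

Definition equivalent (r s t : C) (X : hom1 r s) (Y : hom1 r t) : Prop :=
  exists (E : hom1 t s) (tau : hom2 X (Y ⊗ E)),
    dagger_equivalence E /\ unitary tau.

(* Monoids in the monoidal dagger category End(r). *)
Record monoid (r : C) := Monoid {
  carrier :> hom1 r r;
  mon_mul : hom2 (carrier ⊗ carrier) carrier;
  mon_unit : hom2 (id1 r) carrier;
  monoidA : mon_mul ∘ (mon_mul ⊠ id2 carrier) ∘ asc carrier carrier carrier
            = mon_mul ∘ (id2 carrier ⊠ mon_mul);
  monoid1l : mon_mul ∘ (mon_unit ⊠ id2 carrier) ∘ lunV carrier = id2 carrier;
  monoid1r : mon_mul ∘ (id2 carrier ⊠ mon_unit) ∘ runV carrier = id2 carrier
}.

Record frobenius_monoid (r : C) := FrobeniusMonoid {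
  fmonoid :> monoid r;
  frobeniusl : (mon_mul fmonoid ⊠ id2 fmonoid) ∘ asc fmonoid fmonoid fmonoid
               ∘ (id2 fmonoid ⊠ (mon_mul fmonoid)^†)
               = (mon_mul fmonoid)^† ∘ mon_mul fmonoid;
  frobeniusr : (id2 fmonoid ⊠ mon_mul fmonoid) ∘ ascV fmonoid fmonoid fmonoid
               ∘ ((mon_mul fmonoid)^† ⊠ id2 fmonoid)
               = (mon_mul fmonoid)^† ∘ mon_mul fmonoid
}.

Record special_frobenius_monoid (r : C) := SpecialFrobeniusMonoid {
  sfmonoid :> frobenius_monoid r;
  special : mon_mul sfmonoid ∘ (mon_mul sfmonoid)^† = id2 sfmonoid
}.

Definition star_homomorphism (r : C) (A B : frobenius_monoid r)
    (f : hom2 A B) : Prop :=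
  [/\ f ∘ mon_mul A = mon_mul B ∘ (f ⊠ f),
      f ∘ mon_unit A = mon_unit B &
      f^† = run A ∘ (id2 A ⊠ ((mon_unit B)^† ∘ mon_mul B)) ∘ (id2 A ⊠ (f ⊠ id2 B))
            ∘ ascV A A B ∘ (((mon_mul A)^† ∘ mon_unit A) ⊠ id2 B) ∘ lunV B].

Definition unitarily_star_isomorphic (r : C) (A B : frobenius_monoid r) : Prop :=
  exists f : hom2 A B, unitary f /\ star_homomorphism f.

End Notions.

Section PairMonoid.
Variables (K : numClosedFieldType) (C : pivotal_dagger_2category K).
Let ax := lin2catP C.

Lemma comp2Zl (r s : C) (X Y Z : hom1 r s) k (g : hom2 Y Z) (f : hom2 X Y) :
  (k *: g) ∘ f = k *: (g ∘ f).
Proof.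
have L := comp2_linearl ax (Z := Z) f.
have g0 : (0 : hom2 Y Z) ∘ f = 0.
  by have := L 1 0 0; rewrite !scale1r addr0 -[X in X = _]addr0 => /addrI ->.
by have := L k g 0; rewrite addr0 g0 addr0.
Qed.

Lemma comp2Zr (r s : C) (X Y Z : hom1 r s) k (g : hom2 Y Z) (f : hom2 X Y) :
  g ∘ (k *: f) = k *: (g ∘ f).
Proof.
have L := comp2_linearr ax (X := X) g.
have f0 : g ∘ (0 : hom2 X Y) = 0.
  by have := L 1 0 0; rewrite !scale1r addr0 -[X in X = _]addr0 => /addrI ->.
by have := L k f 0; rewrite addr0 f0 addr0.
Qed.

Lemma tens2Zl (r s t : C) (X X' : hom1 r s) (Y Y' : hom1 s t) k
  (f : hom2 X X') (g : hom2 Y Y') : (k *: f) ⊠ g = k *: (f ⊠ g).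
Proof.
have L := tens2_linearl ax (X := X) (X' := X') g.
have f0 : (0 : hom2 X X') ⊠ g = 0.
  by have := L 1 0 0; rewrite !scale1r addr0 -[X in X = _]addr0 => /addrI ->.
by have := L k f 0; rewrite addr0 f0 addr0.
Qed.

Lemma tens2Zr (r s t : C) (X X' : hom1 r s) (Y Y' : hom1 s t) k
  (f : hom2 X X') (g : hom2 Y Y') : f ⊠ (k *: g) = k *: (f ⊠ g).
Proof.
have L := tens2_linearr ax (Y := Y) (Y' := Y') f.
have g0 : f ⊠ (0 : hom2 Y Y') = 0.
  by have := L 1 0 0; rewrite !scale1r addr0 -[X in X = _]addr0 => /addrI ->.
by have := L k g 0; rewrite addr0 g0 addr0.
Qed.

Lemma dagZ (r s : C) (X Y : hom1 r s) k (f : hom2 X Y) :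
  (k *: f)^† = k^* *: f^†.
Proof.
have L := @dag_antilinear _ C _ _ X Y.
have d0 : (0 : hom2 X Y)^† = 0.
  have := L 1 0 0.
  by rewrite scale1r conjC1 scale1r addr0 -[X in X = _]addr0 => /addrI ->.
by have := L k f 0; rewrite addr0 d0 addr0.
Qed.

Lemma dag_idto (r s : C) (X Y : hom1 r s) (p : X = Y) :
  (idto p : hom2 X Y)^† = idto (esym p).
Proof. by destruct p; rewrite /= dag_id. Qed.

Lemma Cell_dag (r s : C) (X Y X' Y' : hom1 r s) (f : hom2 X Y) (f' : hom2 X' Y') :
  Cell f = Cell f' -> Cell f^† = Cell f'^†.
Proof.
case/CellP => p [q]; destruct p, q.
by rewrite /= (comp2_1l ax) (comp2_1r ax) => ->.
Qed.

Variables (r s : C) (X : hom1 r s) (d : K).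
Hypotheses (d_gt0 : 0 < d) (dimE : dimL X = d *: id2 (id1 s)).

Let D := chosen_dual X.
Let n := cup D.
Let e := cap D.
Let N := D ⊗ X.
Let A := X ⊗ D.

Lemma snakel_dag : Cell ((id2 X ⊠ n^†) ∘ ascV X D X ∘ (e^† ⊠ id2 X)) = Cell (id2 X).
Proof.
have := congr1 (@dag _ _ _ _ _ _) (snakel D).
rewrite !dag_comp !dag_tens !dag_id !dag_idto => E.
rewrite -[RHS](congr1 (@Cell _ _ _ _ _ _) E).
by rewrite Cell_idtol !(comp2A ax) Cell_idtor.
Qed.

Lemma snaker_dag :
  Cell ((n^† ⊠ id2 D) ∘ asc D X D ∘ (id2 D ⊠ e^†)) = Cell (id2 (D : hom1 _ _)).
Proof.
have := congr1 (@dag _ _ _ _ _ _) (snaker D).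
rewrite !dag_comp !dag_tens !dag_id !dag_idto => E.
rewrite -[RHS](congr1 (@Cell _ _ _ _ _ _) E).
by rewrite Cell_idtol !(comp2A ax) Cell_idtor esymK.
Qed.

Let mul0 : hom2 (A ⊗ A) A :=
  (id2 X ⊠ (lun D ∘ (n^† ⊠ id2 D) ∘ asc D X D)) ∘ ascV X D A.

Definition pair_mul :
  hom2 ((X ⊗ chosen_dual X) ⊗ (X ⊗ chosen_dual X)) (X ⊗ chosen_dual X) :=
  (sqrtC d)^-1 *:
  ((id2 X ⊠ (lun (chosen_dual X) ∘ ((cup (chosen_dual X))^† ⊠ id2 (chosen_dual X))
             ∘ asc (chosen_dual X) X (chosen_dual X)))
   ∘ ascV X (chosen_dual X) (X ⊗ chosen_dual X)).

Definition pair_unit : hom2 (id1 r) (X ⊗ chosen_dual X) :=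
  sqrtC d *: (cap (chosen_dual X))^†.

Let sand (P Q : hom1 s s) (f : hom2 P Q) := (id2 X ⊠ f) ⊠ id2 D.

Let sand_comp (P Q R : hom1 s s) (g : hom2 Q R) (f : hom2 P Q) :
  sand (g ∘ f) = sand g ∘ sand f.
Proof. by rewrite /sand whiskerl whiskerr. Qed.

Let mul0E : Cell mul0 = Cell (sand n^†).
Proof. by rewrite !cellE. Qed.

Let mul0dE : Cell mul0^† = Cell (sand n).
Proof. by rewrite (Cell_dag mul0E) !dag_tens !dag_id dagK. Qed.

Let Cell_sand (P Q P' Q' : hom1 s s) (f : hom2 P Q) (f' : hom2 P' Q') :
  Cell f = Cell f' -> Cell (sand f) = Cell (sand f').
Proof. by move=> E; rewrite !Cell_tens E. Qed.

Let k := (sqrtC d)^-1.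

Let k_neq0 : sqrtC d != 0.
Proof. by rewrite sqrtC_eq0 gt_eqF. Qed.

Let kJ : k^* = k.
Proof. by rewrite geC0_conj // invr_ge0 sqrtC_ge0 ltW. Qed.

Let pmulE : pair_mul = k *: mul0. Proof. by []. Qed.

Let pmuldE : pair_mul^† = k *: mul0^†.
Proof. by rewrite pmulE dagZ kJ. Qed.

Lemma pair_mulA :
  pair_mul ∘ (pair_mul ⊠ id2 A) ∘ asc A A A = pair_mul ∘ (id2 A ⊠ pair_mul).
Proof.
apply: Cell_inj; rewrite Cell_idtor pmulE tens2Zl tens2Zr !(comp2Zl, comp2Zr).
do 2!apply: Cell_scale.
transitivity (Cell (sand (n^† ∘ (lun N ∘ (n^† ⊠ id2 N))))).
  rewrite sand_comp; apply: Cell_comp => //.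
  by rewrite Cell_tens mul0E -!(tens2_id ax) !cellE.
transitivity (Cell (sand (n^† ∘ (run N ∘ (id2 N ⊠ n^†))))).
  apply: Cell_sand; transitivity (Cell (n^† ⊠ n^†)).
    by rewrite -(slider n^† n^†); apply: Cell_comp; rewrite !cellE.
  by rewrite -(slidel n^† n^†); apply: Cell_comp; rewrite !cellE.
rewrite sand_comp; apply: Cell_comp => //.
by rewrite [RHS]Cell_tens mul0E -!(tens2_id ax) !cellE.
Qed.

Lemma pair_mul1l : pair_mul ∘ (pair_unit ⊠ id2 A) ∘ lunV A = id2 A.
Proof.
apply: Cell_inj; rewrite Cell_idtor pmulE tens2Zl !(comp2Zl, comp2Zr).
rewrite scalerA mulVf // scale1r -!(tens2_id ax) [RHS]Cell_tens -snakel_dag.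
rewrite -Cell_tens whiskerr; apply: Cell_comp; first by rewrite mul0E !cellE.
by rewrite !cellE.
Qed.

Lemma pair_mul1r : pair_mul ∘ (id2 A ⊠ pair_unit) ∘ runV A = id2 A.
Proof.
apply: Cell_inj; rewrite Cell_idtor pmulE tens2Zr !(comp2Zl, comp2Zr).
rewrite scalerA mulVf // scale1r -!(tens2_id ax) [RHS]Cell_tens -snaker_dag.
rewrite -Cell_tens whiskerl; apply: Cell_comp; first by rewrite mul0E !cellE.
by rewrite !cellE.
Qed.

Lemma pair_frobl :
  (pair_mul ⊠ id2 A) ∘ asc A A A ∘ (id2 A ⊠ pair_mul^†)
  = pair_mul^† ∘ pair_mul.
Proof.
apply: Cell_inj; rewrite pmuldE pmulE tens2Zl tens2Zr !(comp2Zl, comp2Zr).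
do 2!apply: Cell_scale.
transitivity (Cell (sand (n^† ⊠ n))).
  rewrite -(slidel n^† n) sand_comp; apply: Cell_comp.
    by rewrite Cell_idtor Cell_tens mul0E -!(tens2_id ax) !cellE.
  by rewrite Cell_tens mul0dE -!(tens2_id ax) !cellE.
rewrite -(slider n^† n) sand_comp; apply: Cell_comp.
  by rewrite mul0dE !cellE.
by rewrite mul0E !cellE.
Qed.

Lemma pair_frobr :
  (id2 A ⊠ pair_mul) ∘ ascV A A A ∘ (pair_mul^† ⊠ id2 A)
  = pair_mul^† ∘ pair_mul.
Proof.
apply: Cell_inj; rewrite pmuldE pmulE tens2Zl tens2Zr !(comp2Zl, comp2Zr).
do 2!apply: Cell_scale.
transitivity (Cell (sand (n ⊠ n^†))).
  rewrite -(slider n n^†) sand_comp; apply: Cell_comp.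
    by rewrite Cell_idtor Cell_tens mul0E -!(tens2_id ax) !cellE.
  by rewrite Cell_tens mul0dE -!(tens2_id ax) !cellE.
rewrite -(slidel n n^†) sand_comp; apply: Cell_comp.
  by rewrite mul0dE !cellE.
by rewrite mul0E !cellE.
Qed.

Lemma pair_special : pair_mul ∘ pair_mul^† = id2 A.
Proof.
apply: Cell_inj; rewrite pmuldE pmulE !(comp2Zl, comp2Zr) scalerA.
have -> : Cell (id2 A) = Cell ((k * k) *: sand (n^† ∘ n)).
  rewrite [n^† ∘ n]dimE /sand tens2Zr tens2Zl scalerA -invfM -expr2 sqrtCK.
  by rewrite mulVf ?gt_eqF // scale1r /A -(tens2_id ax X) !cellE.
by apply: Cell_scale; rewrite sand_comp; apply: Cell_comp.
Qed.

Definition pair_monoid : special_frobenius_monoid r :=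
  @SpecialFrobeniusMonoid K C r
    (@FrobeniusMonoid K C r
      (@Monoid K C r (X ⊗ chosen_dual X) pair_mul pair_unit
        pair_mulA pair_mul1l pair_mul1r)
      pair_frobl pair_frobr)
    pair_special.

End PairMonoid.

(* Main.v *)
From HB Require Import structures.
From Pilot Require Import Defs.
From mathcomp Require Import all_boot all_order all_algebra.
From mathcomp Require Import reals complex.
Import Order.TTheory GRing.Theory Num.Theory.
Import Pilot.Defs.
Local Open Scope ring_scope.

Set Implicit Arguments.
Unset Strict Implicit.
Unset Printing Implicit Defensive.

(** Write DX for the chosen dual of X, A = X ⊗ DX and B = Y ⊗ DY, and draw
2-morphisms as string diagrams.

From an isomorphism to an equivalence. Let f : A -> B be unitary and
multiplicative. Bending the last leg of f down gives the mate
F = (f ⊠ X) ∘ (X ⊠ η_X) : X -> Y ⊗ DY ⊗ X. Unitarity of f gives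
F^† ∘ F = dX, and multiplicativity of f gives F ∘ F^† = dX (Y ⊠ p), where p on
DY ⊗ X is f with both outer legs bent ([rotation_mate]). A partial trace over Y
cancels Y on the left ([lwhisk_inj]), so p is a dagger idempotent. Splitting it
as p = i ∘ i^† with i : E -> DY ⊗ X turns a multiple of F into a unitary τ : X -> Y ⊗ E
([comparison_unitary]), and bending a multiple of i gives j : E ⊗ DX -> DY with
f = (Y ⊠ j) ∘ (τ ⊠ DX), so j ∘ j^† = 1. The same construction for f^† gives E' as a
summand of DX ⊗ Y. A multiple of the cup of Y composed with j^† is an isometry
id -> E ⊗ DX ⊗ Y whose range projection is the one defining E ⊗ E'; so it
corestricts to a unitary id -> E ⊗ E' ([equivalence_unit]), and exchanging the
roles of X and Y gives id -> E' ⊗ E.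

From an equivalence to an isomorphism. Let τ : X -> Y ⊗ E be unitary. The
pivotal structure makes transposition commute with the dagger and makes the
canonical map between D(Y ⊗ E) and DE ⊗ DY unitary; hence there is a unitary
μ : DX -> DE ⊗ DY such that τ and μ together carry the cups and caps of X to
those of Y ⊗ E ([exists_conj_pair]). Comparing dimensions,
dim_L(E) = dX / dY. Since E is invertible and t is simple, every
endomorphism of E ⊗ DE is a scalar, so the cap of E is a unitary divided by the
square root of dim_L(E). Therefore f = sqrt(dX / dY) (Y ⊠ ε_E ⊠ DY) ∘ (τ ⊠ μ)
is unitary; it is multiplicative and unital because the snake equation then
reads E ⊠ η_E^† = (dX / dY) (ε_E ⊠ E) ([cupw_dagE]). The formula for f^† in
the definition of a star homomorphism holds for every unitary isomorphism of
Frobenius monoids ([star_homomorphism_of_unitary]).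

All diagrams are computed on left-nested composites W ⊗ X1 ⊗ ... ⊗ Xn with a
variable prefix W: a generator acts on the last factors of its prefix and is
whiskered only on the right, so that associators never occur in a
calculation. *)

(** * Left-nested whiskering *)

Local Notation "f ▷ Z" := (f ⊠ id2 Z) (at level 38, left associativity).

(** The proofs p and p' absorb the associators: they allow W ⊗ P and W ⊗ Q to be
given with the factors of P and Q nested to the left. *)
HB.lock Definition lwhisk (K : numClosedFieldType)
    (C : pivotal_dagger_2category K) (q r s : C) (W : hom1 q r) (P Q : hom1 r s)
    (WP WQ : hom1 q s) (p : W ⊗ P = WP) (p' : W ⊗ Q = WQ) (h : hom2 P Q) :
  hom2 WP WQ := idto p' ∘ (id2 W ⊠ h) ∘ idto (esym p).

Section Whiskering.
Variables (K : numClosedFieldType) (C : pivotal_dagger_2category K).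
Let ax := lin2catP C.

Lemma whiskerr_dag (r s t : C) (X Y : hom1 r s) (Z : hom1 s t) (f : hom2 X Y) :
  (f ▷ Z)^† = f^† ▷ Z.
Proof. by rewrite dag_tens dag_id. Qed.

Lemma asc_ascV (q r s t : C) (X : hom1 q r) (Y : hom1 r s) (Z : hom1 s t) :
  asc X Y Z ∘ ascV X Y Z = id2 _.
Proof. by apply: Cell_inj; rewrite Cell_idtol Cell_idto. Qed.

Lemma ascV_asc (q r s t : C) (X : hom1 q r) (Y : hom1 r s) (Z : hom1 s t) :
  ascV X Y Z ∘ asc X Y Z = id2 _.
Proof. by apply: Cell_inj; rewrite Cell_idtol Cell_idto. Qed.

Lemma asc_dag (q r s t : C) (X : hom1 q r) (Y : hom1 r s) (Z : hom1 s t) :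
  (asc X Y Z)^† = ascV X Y Z.
Proof. exact: dag_idto. Qed.

Lemma ascV_dag (q r s t : C) (X : hom1 q r) (Y : hom1 r s) (Z : hom1 s t) :
  (ascV X Y Z)^† = asc X Y Z.
Proof. by rewrite -asc_dag dagK. Qed.

Lemma slide_whisker (r s t : C) (X X' : hom1 r s) (Y Y' : hom1 s t)
  (g : hom2 X X') (h : hom2 Y Y') : (id2 X' ⊠ h) ∘ (g ▷ Y) = (g ▷ Y') ∘ (id2 X ⊠ h).
Proof. by rewrite slidel slider. Qed.

(** Whiskering by an identity 1-morphism is the identity up to identity
cells. *)
Lemma lwhisk1_inj (r s : C) (P Q : hom1 r s) (h h' : hom2 P Q) :
  id2 (id1 r) ⊠ h = id2 (id1 r) ⊠ h' -> h = h'.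
Proof.
move=> E; apply: Cell_inj.
by rewrite -[Cell h]ctens1l -[Cell h']ctens1l -!Cell_tens E.
Qed.

(** Up to identity cells [lwhisk] is plain whiskering; every coherence question
below is settled by comparing cells. *)
Lemma Cell_lwhisk (q r s : C) (W : hom1 q r) (P Q : hom1 r s) (WP WQ : hom1 q s)
    (p : W ⊗ P = WP) (p' : W ⊗ Q = WQ) (h : hom2 P Q) :
  Cell (lwhisk p p' h) = ctens (Cell (id2 W)) (Cell h).
Proof. by rewrite unlock !cellE. Qed.

Lemma lwhisk_comp (q r s : C) (W : hom1 q r) (P Q U : hom1 r s)
    (WP WQ WU : hom1 q s) (p : W ⊗ P = WP) (p' : W ⊗ Q = WQ) (p'' : W ⊗ U = WU)
    (h' : hom2 Q U) (h : hom2 P Q) :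
  lwhisk p p'' (h' ∘ h) = lwhisk p' p'' h' ∘ lwhisk p p' h.
Proof.
apply: Cell_inj; rewrite Cell_lwhisk -Cell_tens whiskerl.
by apply: Cell_comp; rewrite Cell_lwhisk.
Qed.

Lemma lwhisk_id (q r s : C) (W : hom1 q r) (P : hom1 r s) (WP : hom1 q s)
    (p : W ⊗ P = WP) : lwhisk p p (id2 P) = id2 WP.
Proof.
by apply: Cell_inj; rewrite Cell_lwhisk -Cell_tens (tens2_id ax); apply: Cell_id.
Qed.

Lemma lwhisk_dag (q r s : C) (W : hom1 q r) (P Q : hom1 r s) (WP WQ : hom1 q s)
    (p : W ⊗ P = WP) (p' : W ⊗ Q = WQ) (h : hom2 P Q) :
  (lwhisk p p' h)^† = lwhisk p' p h^†.
Proof.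
by rewrite unlock !dag_comp dag_tens dag_id !dag_idto esymK (comp2A ax).
Qed.

Lemma lwhiskZ (q r s : C) (W : hom1 q r) (P Q : hom1 r s) (WP WQ : hom1 q s)
    (p : W ⊗ P = WP) (p' : W ⊗ Q = WQ) k (h : hom2 P Q) :
  lwhisk p p' (k *: h) = k *: lwhisk p p' h.
Proof. by rewrite unlock tens2Zr comp2Zr comp2Zl. Qed.

(** The interchange law. The maps gP and gQ are g whiskered on the right, given
only up to cells so that they may be written with nested factors. *)
Lemma lwhisk_nat (q r s : C) (W W' : hom1 q r) (P Q : hom1 r s)
    (WP WQ WP' WQ' : hom1 q s) (p : W ⊗ P = WP) (p' : W ⊗ Q = WQ)
    (q1 : W' ⊗ P = WP') (q2 : W' ⊗ Q = WQ') (g : hom2 W W') (h : hom2 P Q)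
    (gP : hom2 WP WP') (gQ : hom2 WQ WQ') :
  Cell gP = Cell (g ▷ P) -> Cell gQ = Cell (g ▷ Q) ->
  lwhisk q1 q2 h ∘ gP = gQ ∘ lwhisk p p' h.
Proof.
move=> gPE gQE; apply: Cell_inj.
transitivity (Cell (g ⊠ h)).
  by rewrite -(slider g h); apply: Cell_comp; rewrite ?Cell_lwhisk.
by rewrite -(slidel g h); apply/esym/Cell_comp; rewrite ?Cell_lwhisk.
Qed.

Section Dual.
Variables (r s : C) (X : hom1 r s) (D : right_dual X).

Definition cupw (q : C) (W : hom1 q s) : hom2 W (W ⊗ D ⊗ X) :=
  lwhisk (comp1_1r W) (comp1A W D X) (cup D).

Definition capw (q : C) (W : hom1 q r) : hom2 (W ⊗ X ⊗ D) W :=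
  lwhisk (comp1A W X D) (comp1_1r W) (cap D).

Lemma cupw_nat (q : C) (W W' : hom1 q s) (g : hom2 W W') :
  cupw W' ∘ g = (g ▷ D ▷ X) ∘ cupw W.
Proof. by apply: lwhisk_nat; rewrite -?(tens2_id ax) ?cellE. Qed.

Lemma capw_nat (q : C) (W W' : hom1 q r) (g : hom2 W W') :
  capw W' ∘ (g ▷ X ▷ D) = g ∘ capw W.
Proof. by apply: lwhisk_nat; rewrite -?(tens2_id ax) ?cellE. Qed.

Lemma zigzagl (q : C) (W : hom1 q r) :
  (capw W ▷ X) ∘ cupw (W ⊗ X) = id2 (W ⊗ X).
Proof.
apply: Cell_inj.
transitivity (Cell (id2 W ⊠ ((lun X ∘ (cap D ⊠ id2 X) ∘ asc X D X)
                             ∘ (id2 X ⊠ cup D ∘ runV X)))).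
  rewrite whiskerl; apply: Cell_comp.
    by rewrite Cell_tens Cell_lwhisk !cellE.
  by rewrite Cell_lwhisk -(tens2_id ax) !cellE.
by rewrite (comp2A ax) snakel (tens2_id ax).
Qed.

Lemma zigzagr (q : C) (W : hom1 q s) :
  capw (W ⊗ D) ∘ (cupw W ▷ D) = id2 (W ⊗ D).
Proof.
apply: Cell_inj.
transitivity (Cell (id2 W ⊠ ((run D ∘ (id2 D ⊠ cap D) ∘ ascV D X D)
                             ∘ (cup D ⊠ id2 D ∘ lunV D)))).
  rewrite whiskerl; apply: Cell_comp.
    by rewrite Cell_lwhisk -(tens2_id ax) !cellE.
  by rewrite Cell_tens Cell_lwhisk !cellE.
by rewrite (comp2A ax) snaker (tens2_id ax).
Qed.

End Dual.

End Whiskering.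

(* The digits count the factors of the source and of the target of h that become
   separate factors of the nested composite. *)
Local Notation "W ◁21 h" := (lwhisk (comp1A W _ _) erefl h) (at level 38).
Local Notation "W ◁12 h" := (lwhisk erefl (comp1A W _ _) h) (at level 38).
Local Notation "W ◁22 h" := (lwhisk (comp1A W _ _) (comp1A W _ _) h) (at level 38).

(** * From a unitary monoid isomorphism to an equivalence *)

Section EquivalenceFromIsomorphism.
Variables (K : numClosedFieldType) (C : pivotal_dagger_2category K).
Let ax := lin2catP C.

Lemma lwhisk_unitary (q r s : C) (W : hom1 q r) (P Q : hom1 r s)
    (WP WQ : hom1 q s) (p : W ⊗ P = WP) (p' : W ⊗ Q = WQ) (h : hom2 P Q) :
  unitary h ->
  unitary (lwhisk p p' h).
Proof.
case=> hU hUV; rewrite /unitary /isometry lwhisk_dag -!lwhisk_comp.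
by rewrite [_^† ∘ _]hU hUV !lwhisk_id.
Qed.

Lemma whiskerr_unitary (r s t : C) (P Q : hom1 r s) (Z : hom1 s t) (h : hom2 P Q) :
  unitary h -> unitary (h ▷ Z).
Proof.
case=> hU hUV; rewrite /unitary /isometry whiskerr_dag -!whiskerr.
by rewrite [_^† ∘ _]hU hUV !(tens2_id ax).
Qed.

Lemma unitary_comp (r s : C) (P Q U : hom1 r s) (g : hom2 Q U) (h : hom2 P Q) :
  unitary g -> unitary h -> unitary (g ∘ h).
Proof.
case=> gU gUV [hU hUV]; rewrite /unitary /isometry dag_comp.
have {}gU : g^† ∘ g = id2 _ := gU; have {}hU : h^† ∘ h = id2 _ := hU.
split; first by rewrite (comp2A ax) -(comp2A ax _ g^†) gU (comp2_1r ax).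
by rewrite (comp2A ax) -(comp2A ax _ h) hUV (comp2_1r ax).
Qed.

(** An isometry into W ⊗ P whose range projection is W ⊠ (i ∘ i^†) is
corestricted to W ⊗ V by i^†, and thereby becomes onto. Both the comparison
X -> Y ⊗ E and the unit of the equivalence arise in this way. *)
Lemma unitary_of_split (r s t : C) (X : hom1 r s) (W : hom1 r t) (P V : hom1 t s)
    (G : hom2 X (W ⊗ P)) (i : hom2 V P) :
  isometry G -> isometry i -> G ∘ G^† = id2 W ⊠ (i ∘ i^†) ->
  unitary ((id2 W ⊠ i^†) ∘ G).
Proof.
move=> Giso iiso GE; have iiso' : i^† ∘ i = id2 V := iiso; rewrite /unitary /isometry.
rewrite dag_comp dag_tens dag_id dagK; split.
  rewrite -(comp2A ax) (comp2A ax (id2 W ⊠ i)) -whiskerl -GE.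
  by rewrite !(comp2A ax) Giso (comp2_1l ax).
rewrite -(comp2A ax) (comp2A ax G) GE -!whiskerl -(comp2A ax i) iiso'.
by rewrite (comp2_1r ax) iiso' (tens2_id ax).
Qed.

Lemma cupw_dag_nat (q r s : C) (X : hom1 r s) (D : right_dual X) (W W' : hom1 q s)
    (g : hom2 W W') :
  g ∘ (cupw D W)^† = (cupw D W')^† ∘ (g ▷ D ▷ X).
Proof.
have := congr1 (@dag _ _ _ _ _ _) (cupw_nat D g^†).
by rewrite !dag_comp !whiskerr_dag !dagK.
Qed.

Lemma lwhisk12_nat (q r s t : C) (W W' : hom1 q r) (P : hom1 r t) (Q : hom1 r s) (Q' : hom1 s t)
    (h : hom2 P (Q ⊗ Q')) (g : hom2 W W') :
  (W' ◁12 h) ∘ (g ▷ P) = (g ▷ Q ▷ Q') ∘ (W ◁12 h).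
Proof. by apply: lwhisk_nat; rewrite // -(tens2_id ax) !cellE. Qed.

Section Cancel.
Variables (r t : C) (Y : hom1 r t) (D : right_dual Y) (d : K).
Hypotheses (d_neq0 : d != 0) (dimE : (cup D)^† ∘ cup D = d *: id2 (id1 t)).

(** Since Y has nonzero left dimension, h is recovered from Y ⊠ h by closing up
the strand Y: the closed loop contributes the invertible scalar d. *)
Lemma lwhisk_inj (u : C) (P Q : hom1 t u) (h h' : hom2 P Q) :
  id2 Y ⊠ h = id2 Y ⊠ h' -> h = h'.
Proof.
have trE (g : hom2 P Q) : d *: (id2 (id1 t) ⊠ g) =
    ((cup D)^† ▷ Q) ∘ (id2 (D ⊗ Y) ⊠ g) ∘ (cup D ▷ P).
  by rewrite slidel -(interchange ax) (comp2_1r ax) dimE tens2Zl.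
have DYE (g : hom2 P Q) : Cell (id2 (D ⊗ Y) ⊠ g)
    = ctens (Cell (id2 (D : hom1 _ _))) (Cell (id2 Y ⊠ g)).
  by rewrite -(tens2_id ax) !cellE.
move=> hh'; have E : id2 (D ⊗ Y) ⊠ h = id2 (D ⊗ Y) ⊠ h'.
  by apply: Cell_inj; rewrite !DYE hh'.
have /(scalerI d_neq0) E1 : d *: (id2 (id1 t) ⊠ h) = d *: (id2 (id1 t) ⊠ h').
  by rewrite !trE E.
by apply: Cell_inj; rewrite -[Cell h]ctens1l -[Cell h']ctens1l -!Cell_tens E1.
Qed.

Lemma cupw_dim (q : C) (W : hom1 q t) : (cupw D W)^† ∘ cupw D W = d *: id2 W.
Proof. by rewrite lwhisk_dag -lwhisk_comp dimE lwhiskZ lwhisk_id. Qed.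

End Cancel.

Section Rotation.
Variables (r s t : C) (X : hom1 r s) (Y : hom1 r t).
Variables (D : right_dual X) (D' : right_dual Y) (dX c : K).
Variable f : hom2 (X ⊗ D) (Y ⊗ D').
Hypotheses (dX_gt0 : 0 < dX) (c_neq0 : c != 0).
Hypothesis dimX : (cup D)^† ∘ cup D = dX *: id2 (id1 s).
Hypotheses (fU : f^† ∘ f = id2 _) (fUV : f ∘ f^† = id2 _).
Hypothesis fM : c *: (f ∘ ((cupw D X)^† ▷ D)) =
  ((cupw D' Y)^† ▷ D') ∘ (Y ⊗ D' ◁22 f) ∘ (f ▷ X ▷ D).

(* The hypothesis fM says that f is multiplicative for the multiplications
   (X ⊠ η_X^† ⊠ D) and (Y ⊠ η_Y^† ⊠ D') up to a scalar; c is the ratio of the two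
   normalizations. *)

Definition mate : hom2 X (Y ⊗ D' ⊗ X) := (f ▷ X) ∘ cupw D X.

Definition rotation : hom2 (D' ⊗ X) (D' ⊗ X) :=
  (lun D' ▷ X) ∘ ((cup D')^† ▷ D' ▷ X) ∘ ((D' ◁22 f) ▷ X) ∘ cupw D (D' ⊗ X).

Lemma mate_iso : mate^† ∘ mate = dX *: id2 X.
Proof.
rewrite /mate dag_comp whiskerr_dag -(comp2A ax) (comp2A ax (f^† ▷ X)).
by rewrite -whiskerr fU (tens2_id ax) (comp2_1l ax) (cupw_dim dimX).
Qed.

Lemma rotation_nested :
  Y ◁22 rotation = ((cupw D' Y)^† ▷ D' ▷ X) ∘ ((Y ⊗ D' ◁22 f) ▷ X)
                   ∘ cupw D (Y ⊗ D' ⊗ X).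
Proof.
apply: Cell_inj; rewrite Cell_lwhisk -Cell_tens /rotation !whiskerl.
apply: Cell_comp; last by rewrite Cell_tens !Cell_lwhisk -!(tens2_id ax) !cellE.
apply: Cell_comp; last by rewrite !Cell_tens !Cell_lwhisk -!(tens2_id ax) !cellE.
by rewrite -whiskerl -whiskerr !Cell_tens lwhisk_dag Cell_lwhisk !cellE.
Qed.

(** The diagram of [rotation] with Y in front contains the multiplication of
Y ⊗ D' applied to (Y ⊗ D') ⊠ f. Multiplicativity, composed with f^† on the first
factor, moves it to the multiplication of X ⊗ D, which is a cap of X; together
with the cup of X already present, it gives the two halves of the product
of the mate and its dagger. *)
Lemma rotation_mate : Y ◁22 rotation = c *: (mate ∘ mate^†).
Proof.
have fM' : c *: (f ∘ ((cupw D X)^† ▷ D) ∘ (f^† ▷ X ▷ D)) =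
    ((cupw D' Y)^† ▷ D') ∘ (Y ⊗ D' ◁22 f).
  rewrite -comp2Zl fM -(comp2A ax) -!whiskerr fUV.
  by rewrite !(tens2_id ax) (comp2_1r ax).
rewrite rotation_nested -whiskerr -fM' tens2Zl comp2Zl; congr (c *: _).
rewrite !whiskerr -!(comp2A ax) -cupw_nat (comp2A ax _ (cupw D _)) -cupw_nat.
by rewrite /mate dag_comp whiskerr_dag !(comp2A ax).
Qed.

Let dX_neq0 : dX != 0. Proof. by rewrite gt_eqF. Qed.

(** The projection onto the summand E of D' ⊗ X that becomes the equivalence. *)
Definition rotation_proj : hom2 (D' ⊗ X) (D' ⊗ X) := (dX * c)^-1 *: rotation.

Definition unit_mate : hom2 X (Y ⊗ (D' ⊗ X)) :=
  (sqrtC dX)^-1 *: (ascV Y D' X ∘ mate).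

Let k2 : ((sqrtC dX)^-1)^* * (sqrtC dX)^-1 = dX^-1.
Proof.
by rewrite geC0_conj ?invr_ge0 ?sqrtC_ge0 ?ltW // -invfM -expr2 sqrtCK.
Qed.

Lemma unit_mate_iso : isometry unit_mate.
Proof.
rewrite /isometry /unit_mate dagZ comp2Zl comp2Zr scalerA k2.
rewrite dag_comp ascV_dag -(comp2A ax) (comp2A ax (asc _ _ _)) asc_ascV.
by rewrite (comp2_1l ax) mate_iso scalerA mulVf // scale1r.
Qed.

Lemma unit_mate_proj : unit_mate ∘ unit_mate^† = id2 Y ⊠ rotation_proj.
Proof.
rewrite /unit_mate /rotation_proj dagZ comp2Zl comp2Zr scalerA mulrC k2 tens2Zr.
rewrite invfM -scalerA; congr (_ *: _).
have -> : id2 Y ⊠ rotation = ascV Y D' X ∘ (Y ◁22 rotation) ∘ asc Y D' X.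
  by apply: Cell_inj; rewrite Cell_idtor Cell_idtol Cell_lwhisk.
rewrite rotation_mate comp2Zr comp2Zl scalerA mulVf // scale1r.
by rewrite dag_comp ascV_dag !(comp2A ax).
Qed.

Variable dY : K.
Hypotheses (dY_gt0 : 0 < dY) (dimY : (cup D')^† ∘ cup D' = dY *: id2 (id1 t)).
Let dY_neq0 : dY != 0. Proof. by rewrite gt_eqF. Qed.

(** Whiskered by Y, [rotation_proj] is the range projection of an isometry, and
whiskering by Y is injective. *)
Lemma rotation_proj_idem :
  rotation_proj = rotation_proj^† /\ rotation_proj = rotation_proj ∘ rotation_proj.
Proof.
have cc : unit_mate^† ∘ unit_mate = id2 X := unit_mate_iso.
split; apply: (lwhisk_inj dY_neq0 dimY).
  rewrite -[id2 Y in RHS]dag_id -dag_tens -unit_mate_proj.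
  by rewrite dag_comp dagK.
rewrite whiskerl -unit_mate_proj (comp2A ax) -(comp2A ax unit_mate) cc.
by rewrite (comp2_1r ax).
Qed.

Variables (E : hom1 t s) (i : hom2 E (D' ⊗ X)).
Hypotheses (iiso : isometry i) (iproj : i ∘ i^† = rotation_proj).

Definition comparison : hom2 X (Y ⊗ E) := (id2 Y ⊠ i^†) ∘ unit_mate.

Lemma comparison_unitary : unitary comparison.
Proof.
apply: unitary_of_split => //; first exact: unit_mate_iso.
by rewrite iproj unit_mate_proj.
Qed.

(** The splitting i with its leg X bent. The factor is the one that turns the
bent isometry back into f, see [comparison_dualE]. *)
Definition comparison_dual : hom2 (E ⊗ D) D' :=
  sqrtC dX *: (run D' ∘ (id2 D' ⊠ cap D) ∘ ascV D' X D ∘ (i ▷ D)).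

(** Composing i with the comparison undoes the splitting and returns the
normalized mate of f; bending X back with a snake leaves f. *)
Lemma comparison_dualE : (Y ◁21 comparison_dual) ∘ (comparison ▷ D) = f.
Proof.
have sE : Y ◁21 comparison_dual = sqrtC dX *: (capw D (Y ⊗ D') ∘ ((Y ◁12 i) ▷ D)).
  rewrite lwhiskZ; congr (_ *: _); apply: Cell_inj; rewrite Cell_lwhisk.
  rewrite -Cell_tens whiskerl; apply: Cell_comp.
    by rewrite Cell_lwhisk -!(tens2_id ax) !cellE.
  by rewrite !Cell_tens Cell_lwhisk !cellE.
rewrite sE comp2Zl -(comp2A ax) -whiskerr.
have -> : (Y ◁12 i) ∘ comparison = (sqrtC dX)^-1 *: mate.
  rewrite /comparison (comp2A ax).
  have -> : (Y ◁12 i) ∘ (id2 Y ⊠ i^†) = asc Y D' X ∘ (id2 Y ⊠ rotation_proj).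
    rewrite -iproj whiskerl (comp2A ax); congr (_ ∘ _).
    by apply: Cell_inj; rewrite Cell_lwhisk cellE.
  rewrite -unit_mate_proj -!(comp2A ax) [_^† ∘ _]unit_mate_iso (comp2_1r ax).
  by rewrite comp2Zr (comp2A ax) asc_ascV (comp2_1l ax).
rewrite tens2Zl comp2Zr scalerA mulfV ?scale1r ?sqrtC_eq0 //.
rewrite /mate whiskerr (comp2A ax) capw_nat -(comp2A ax) zigzagr.
by rewrite (comp2_1r ax).
Qed.

Lemma comparison_dual_nested : Y ◁21 comparison_dual = f ∘ (comparison^† ▷ D).
Proof.
rewrite -[in RHS]comparison_dualE -(comp2A ax) -whiskerr (proj2 comparison_unitary).
by rewrite !(tens2_id ax) (comp2_1r ax).
Qed.

(** By [comparison_dual_nested], this map whiskered by Y is a composite of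
unitaries. *)
Lemma comparison_dual_coiso : comparison_dual ∘ comparison_dual^† = id2 D'.
Proof.
apply: (lwhisk_inj dY_neq0 dimY); rewrite (tens2_id ax).
have -> : id2 Y ⊠ (comparison_dual ∘ comparison_dual^†)
    = (Y ◁21 comparison_dual) ∘ (Y ◁21 comparison_dual)^†.
  by rewrite lwhisk_dag -lwhisk_comp; apply: Cell_inj; rewrite Cell_lwhisk.
rewrite comparison_dual_nested dag_comp whiskerr_dag dagK -(comp2A ax).
rewrite (comp2A ax (comparison^† ▷ D)) -whiskerr [_^† ∘ _](proj1 comparison_unitary).
by rewrite (tens2_id ax) (comp2_1l ax).
Qed.

Lemma mate_proj : mate ∘ mate^† = dX *: (Y ◁22 rotation_proj).
Proof.
rewrite lwhiskZ rotation_mate !scalerA mulrAC.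
by rewrite mulfV ?mulf_neq0 // scale1r.
Qed.

End Rotation.

Section EquivalenceUnit.
Variables (r s t : C) (X : hom1 r s) (Y : hom1 r t).
Variables (D : right_dual X) (D' : right_dual Y) (dX dY c : K).
Variable f : hom2 (X ⊗ D) (Y ⊗ D').
Hypotheses (dX_gt0 : 0 < dX) (dY_gt0 : 0 < dY) (c_neq0 : c != 0).
Hypothesis dimX : (cup D)^† ∘ cup D = dX *: id2 (id1 s).
Hypothesis dimY : (cup D')^† ∘ cup D' = dY *: id2 (id1 t).
Hypotheses (fU : f^† ∘ f = id2 _) (fUV : f ∘ f^† = id2 _).
Hypothesis fM : c *: (f ∘ ((cupw D X)^† ▷ D)) =
  ((cupw D' Y)^† ▷ D') ∘ (Y ⊗ D' ◁22 f) ∘ (f ▷ X ▷ D).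

(** A unitary f satisfies f^† = f^-1, so f^† is multiplicative as well; this makes
the construction symmetric in X and Y. *)
Lemma dag_nested_mult : c^-1 *: (f^† ∘ ((cupw D' Y)^† ▷ D')) =
  ((cupw D X)^† ▷ D) ∘ (X ⊗ D ◁22 f^†) ∘ (f^† ▷ Y ▷ D').
Proof.
have nat : (X ⊗ D ◁22 f^†) ∘ (f^† ▷ Y ▷ D') = (f^† ▷ X ▷ D) ∘ (Y ⊗ D' ◁22 f^†).
  by apply: lwhisk_nat; rewrite -?(tens2_id ax) ?cellE.
rewrite -(comp2A ax) nat.
have <- : c^-1 *: (f^† ∘ (c *: (f ∘ ((cupw D X)^† ▷ D)))) = (cupw D X)^† ▷ D.
  by rewrite comp2Zr scalerA mulVf // scale1r (comp2A ax) fU (comp2_1l ax).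
rewrite comp2Zl fM; congr (_ *: _); rewrite -!(comp2A ax); congr (_ ∘ _).
rewrite (comp2A ax (f ▷ X ▷ D)) -!whiskerr fUV !(tens2_id ax) (comp2_1l ax).
by rewrite -lwhisk_comp fUV lwhisk_id (comp2_1r ax).
Qed.

Variables (E : hom1 t s) (i : hom2 E (D' ⊗ X)).
Variables (E' : hom1 s t) (i' : hom2 E' (D ⊗ Y)).
Hypotheses (iiso : isometry i) (iproj : i ∘ i^† = rotation_proj dX c f).
Hypothesis i'iso : isometry i'.
Hypothesis i'proj : i' ∘ i'^† = rotation_proj dY c^-1 f^†.

(** The map G is the cup of Y pushed through j^†. To see that its range projection
is E ⊠ (i' ∘ i'^†), whisker by Y: since Y ⊠ j^† is (τ ⊠ D) ∘ f^†, the map Y ⊠ G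
becomes the mate of f^† conjugated by τ, and the range projection of that mate is
known from [mate_proj]. *)
Lemma equivalence_unit : exists u : hom2 (id1 t) (E ⊗ E'), unitary u.
Proof.
pose tau := comparison dX f i; pose j := comparison_dual D dX i.
have tauU : unitary tau by apply: (comparison_unitary (c := c)).
have jE : Y ◁21 j = f ∘ (tau^† ▷ D).
  by apply: (comparison_dual_nested (c := c)).
have jj : j ∘ j^† = id2 D'.
  by apply: comparison_dual_coiso dY_gt0 dimY _ _ _ iproj.
have dY_neq0 : dY != 0 by rewrite gt_eqF.
pose k := (sqrtC dY)^-1.
have kJ : k^* = k by rewrite geC0_conj // invr_ge0 sqrtC_ge0 ltW.
have kk : k * k = dY^-1 by rewrite -invfM -expr2 sqrtCK.
pose G : hom2 (id1 t) (E ⊗ (D ⊗ Y)) := k *: (ascV E D Y ∘ (j^† ▷ Y) ∘ cup D').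
exists ((id2 E ⊠ i'^†) ∘ G); apply: unitary_of_split => //.
  rewrite /isometry /G dagZ comp2Zl comp2Zr scalerA kJ kk !dag_comp.
  rewrite ascV_dag whiskerr_dag dagK.
  rewrite !(comp2A ax) -(comp2A ax _ (asc _ _ _)) asc_ascV (comp2_1r ax).
  rewrite -(comp2A ax _ (j ▷ Y)) -whiskerr jj (tens2_id ax) (comp2_1r ax) dimY.
  by rewrite scalerA mulVf // scale1r.
rewrite i'proj; apply: (lwhisk_inj dY_neq0 dimY).
have [m mE] : exists m, m = mate f^† by exists (mate f^†).
have mm : m ∘ m^† = dY *: (X ◁22 rotation_proj dY c^-1 f^†).
  rewrite mE; apply: mate_proj; rewrite ?invr_eq0 ?dagK //.
  exact: dag_nested_mult.
have p : Y ⊗ (E ⊗ (D ⊗ Y)) = Y ⊗ E ⊗ D ⊗ Y.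
  by rewrite !comp1A.
have GE : lwhisk (comp1_1r Y) p G = k *: ((tau ▷ D ▷ Y) ∘ m).
  rewrite lwhiskZ; congr (_ *: _).
  transitivity (((Y ◁21 j)^† ▷ Y) ∘ cupw D' Y); last first.
    by rewrite jE mE dag_comp whiskerr_dag dagK whiskerr -(comp2A ax).
  apply: Cell_inj; rewrite Cell_lwhisk -Cell_tens whiskerl; apply: Cell_comp.
    by rewrite lwhisk_dag !Cell_tens Cell_lwhisk !cellE.
  by rewrite Cell_lwhisk.
have : lwhisk p p (G ∘ G^†) = (Y ⊗ E) ◁22 rotation_proj dY c^-1 f^†.
  rewrite (lwhisk_comp _ (comp1_1r Y)) -lwhisk_dag GE dagZ comp2Zl comp2Zr.
  rewrite scalerA kJ kk dag_comp !(comp2A ax) -(comp2A ax _ m) mm.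
  rewrite comp2Zr comp2Zl scalerA mulVf // scale1r.
  have <- : (Y ⊗ E ◁22 rotation_proj dY c^-1 f^†) ∘ (tau ▷ D ▷ Y)
      = (tau ▷ D ▷ Y) ∘ (X ◁22 rotation_proj dY c^-1 f^†).
    by apply: lwhisk_nat; rewrite -(tens2_id ax) !cellE.
  rewrite -(comp2A ax) !whiskerr_dag -!whiskerr (proj2 tauU).
  by rewrite !(tens2_id ax) (comp2_1r ax).
move=> GG; apply: Cell_inj; rewrite Cell_tens -(Cell_lwhisk p p) GG.
by rewrite Cell_lwhisk -(tens2_id ax) !cellE.
Qed.

End EquivalenceUnit.
End EquivalenceFromIsomorphism.

(** * The monoid X ⊗ DX in nested form *)

Section PairMonoids.
Variables (K : numClosedFieldType) (C : pivotal_dagger_2category K).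
Let ax := lin2catP C.

Lemma pair_mulE (r s : C) (X : hom1 r s) (d : K) :
  pair_mul X d = (sqrtC d)^-1 *: (((cupw (chosen_dual X) X)^† ▷ chosen_dual X)
     ∘ asc (X ⊗ chosen_dual X) X (chosen_dual X)).
Proof.
rewrite /pair_mul; congr (_ *: _); apply: Cell_inj.
by rewrite !Cell_idtor !Cell_tens lwhisk_dag Cell_lwhisk !cellE.
Qed.

Section Two.
Variables (r s t : C) (X : hom1 r s) (Y : hom1 r t) (dX dY : K).
Hypothesis dY_gt0 : 0 < dY.
Let D := chosen_dual X.
Let D' := chosen_dual Y.
Variable f : hom2 (X ⊗ D) (Y ⊗ D').

(** Clearing the associators and the factors (sqrt dX)^-1 and (sqrt dY)^-1 of the
two multiplications; only their ratio remains. *)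
Lemma nested_multP :
  f ∘ pair_mul X dX = pair_mul Y dY ∘ (f ⊠ f) <->
  (sqrtC dY / sqrtC dX) *: (f ∘ ((cupw D X)^† ▷ D)) =
  ((cupw D' Y)^† ▷ D') ∘ (Y ⊗ D' ◁22 f) ∘ (f ▷ X ▷ D).
Proof.
have sY : sqrtC dY != 0 by rewrite sqrtC_eq0 gt_eqF.
have ffE : asc (Y ⊗ D') Y D' ∘ (f ⊠ f) =
    (Y ⊗ D' ◁22 f) ∘ (f ▷ X ▷ D) ∘ asc (X ⊗ D) X D.
  apply: Cell_inj; rewrite Cell_idtor Cell_idtol -(slider f f).
  apply: Cell_comp; first by rewrite Cell_lwhisk.
  by rewrite -(tens2_id ax) !cellE.
rewrite !pair_mulE comp2Zl comp2Zr -(comp2A ax _ _ (f ⊠ f)) ffE !(comp2A ax).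
split=> [/(congr1 (fun g => sqrtC dY *: (g ∘ ascV (X ⊗ D) X D)))|<-]; last first.
  by rewrite comp2Zl scalerA mulKf.
by rewrite !comp2Zl !scalerA mulfV // scale1r -!(comp2A ax) asc_ascV !(comp2_1r ax).
Qed.

End Two.

(** The projections attached to f and to f^† are split as E and E'; the two
units come from [equivalence_unit] applied to f and to f^†. *)
Lemma equivalent_of_star_iso (split : split_dagger_idempotents C)
  (r s t : C) (X : hom1 r s) (Y : hom1 r t) (dX dY : K)
  (dX_gt0 : 0 < dX) (dY_gt0 : 0 < dY)
  (dimX : dimL X = dX *: id2 (id1 s)) (dimY : dimL Y = dY *: id2 (id1 t)) :
  unitarily_star_isomorphic (pair_monoid dX_gt0 dimX) (pair_monoid dY_gt0 dimY) ->
  equivalent X Y.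
Proof.
case=> f [[fU fUV] [/= fM _ _]].
have c_neq0 : sqrtC dY / sqrtC dX != 0.
  by rewrite mulf_neq0 ?invr_eq0 ?sqrtC_eq0 ?gt_eqF.
have {}fM := (nested_multP dX dY_gt0 f).1 fM.
have gM := dag_nested_mult c_neq0 fU fUV fM.
have c'_neq0 : (sqrtC dY / sqrtC dX)^-1 != 0 by rewrite invr_eq0.
have gU : f^†^† ∘ f^† = id2 _ by rewrite dagK.
have gUV : f^† ∘ f^†^† = id2 _ by rewrite dagK.
have [pJ pI] := rotation_proj_idem dX_gt0 c_neq0 dimX fU fUV fM dY_gt0 dimY.
have [qJ qI] := rotation_proj_idem dY_gt0 c'_neq0 dimY gU gUV gM dX_gt0 dimX.
have [E [i [iiso iproj]]] := split _ _ _ _ pJ pI.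
have [E' [i' [i'iso i'proj]]] := split _ _ _ _ qJ qI.
exists E, (comparison dX f i); split; last first.
  by apply: (comparison_unitary dX_gt0 c_neq0 dimX).
have [u uU] : exists u : hom2 (id1 t) (E ⊗ E'), unitary u.
  by apply: (equivalence_unit dX_gt0 dY_gt0 c_neq0 dimX dimY fU fUV fM
               iiso iproj i'iso).
have [v vU] : exists u : hom2 (id1 s) (E' ⊗ E), unitary u.
  apply: (equivalence_unit dY_gt0 dX_gt0 c'_neq0 dimY dimX gU gUV gM
            i'iso i'proj iiso).
  by rewrite dagK invrK.
exists E', v, u^†; split=> //.
by case: uU; rewrite /unitary /isometry dagK.
Qed.

End PairMonoids.

(** * Unitary monoid isomorphisms are star homomorphisms *)

Section Star.
Variables (K : numClosedFieldType) (C : pivotal_dagger_2category K).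
Let ax := lin2catP C.

(** A unitary f that preserves the unit also preserves the counit u^†. Hence the
pairing u_B^† ∘ m_B ∘ (f ⊠ B) equals u_A^† ∘ m_A ∘ (A ⊠ f^†), so f^† can be pulled to
the front of the defining formula, and the Frobenius and unit laws reduce what
remains to an identity. *)
Lemma star_homomorphism_of_unitary (r : C) (A B : frobenius_monoid r) (f : hom2 A B) :
  unitary f -> f ∘ mon_mul A = mon_mul B ∘ (f ⊠ f) ->
  f ∘ mon_unit A = mon_unit B -> star_homomorphism f.
Proof.
case=> fU fUV fM fu; have {}fU : f^† ∘ f = id2 _ := fU; split=> //.
have counitE : (mon_unit B)^† ∘ f = (mon_unit A)^†.
  by rewrite -fu dag_comp -(comp2A ax) fU (comp2_1r ax).
have formE : (mon_unit B)^† ∘ mon_mul B ∘ (f ⊠ id2 B)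
    = (mon_unit A)^† ∘ mon_mul A ∘ (id2 A ⊠ f^†).
  have -> : f ⊠ id2 B = (f ⊠ f) ∘ (id2 A ⊠ f^†).
    by rewrite -(interchange ax) (comp2_1r ax) fUV.
  by rewrite (comp2A ax) -(comp2A ax _ (mon_mul B)) -fM (comp2A ax) counitE.
rewrite -!(comp2A ax) (comp2A ax (id2 A ⊠ _)) -whiskerl formE.
have shift : (id2 A ⊠ (id2 A ⊠ f^†)) ∘ ascV A A B
      ∘ (((mon_mul A)^† ∘ mon_unit A) ▷ B) ∘ lunV B
    = ascV A A A ∘ (((mon_mul A)^† ∘ mon_unit A) ▷ A) ∘ lunV A ∘ f^†.
  have -> : (id2 A ⊠ (id2 A ⊠ f^†)) ∘ ascV A A B = ascV A A A ∘ (id2 (A ⊗ A) ⊠ f^†).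
    by apply: Cell_inj; rewrite Cell_idtor Cell_idtol -(tens2_id ax) !cellE.
  rewrite -(comp2A ax (ascV _ _ _)) slide_whisker (comp2A ax) -!(comp2A ax).
  congr (_ ∘ (_ ∘ _)).
  by apply: Cell_inj; rewrite Cell_idtor Cell_idtol !cellE.
rewrite !whiskerl -!(comp2A ax) (comp2A ax (id2 A ⊠ (id2 A ⊠ _))).
rewrite !(comp2A ax) in shift *.
have unitE : mon_mul A ∘ (mon_unit A ▷ A) ∘ lunV A = id2 A := monoid1l A.
have unitEr : run A ∘ (id2 A ⊠ (mon_unit A)^†) ∘ (mon_mul A)^† = id2 A.
  have := congr1 (@dag _ _ _ _ _ _) (monoid1r A).
  by rewrite !dag_comp dag_id dag_tens dag_id dag_idto esymK (comp2A ax).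
rewrite -!(comp2A ax) in shift *; rewrite shift whiskerr.
have fr : (id2 A ⊠ mon_mul A) ∘ ascV A A A ∘ ((mon_mul A)^† ▷ A)
    = (mon_mul A)^† ∘ mon_mul A := frobeniusr A.
rewrite !(comp2A ax) -(comp2A ax _ (id2 A ⊠ mon_mul A) (ascV A A A)).
rewrite -(comp2A ax _ ((id2 A ⊠ mon_mul A) ∘ ascV A A A)) fr.
rewrite (comp2A ax) unitEr (comp2_1l ax).
by rewrite unitE (comp2_1l ax).
Qed.

End Star.

(** * Transposition and conjugate pairs *)

Section Transposition.
Variables (K : numClosedFieldType) (C : pivotal_dagger_2category K).
Let ax := lin2catP C.

Section NonDegenerate.
Variables (r s : C) (X : hom1 r s) (D : right_dual X).

(** By the snake equations a cap is nondegenerate in each of its two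
arguments. *)
Lemma capw_injr (P : hom1 s r) (h h' : hom2 P D) :
  (forall W : hom1 s r,
     capw D W ∘ (id2 (W ⊗ X) ⊠ h) = capw D W ∘ (id2 (W ⊗ X) ⊠ h')) ->
  h = h'.
Proof.
move=> E; apply: lwhisk1_inj.
have hE (g : hom2 P D) : id2 (id1 s) ⊠ g =
    capw D (id1 s ⊗ D) ∘ (id2 (id1 s ⊗ D ⊗ X) ⊠ g) ∘ (cupw D (id1 s) ▷ P).
  by rewrite -(comp2A ax) slide_whisker (comp2A ax) zigzagr (comp2_1l ax).
by rewrite hE E -hE.
Qed.

Lemma capw_injl (P : hom1 r s) (g g' : hom2 P X) :
  (forall W : hom1 r r,
     capw D W ∘ ((id2 W ⊠ g) ▷ D) = capw D W ∘ ((id2 W ⊠ g') ▷ D)) ->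
  g = g'.
Proof.
move=> E; apply: lwhisk1_inj.
have gE (h : hom2 P X) : id2 (id1 r) ⊠ h =
    ((capw D (id1 r) ∘ ((id2 (id1 r) ⊠ h) ▷ D)) ▷ X) ∘ cupw D (id1 r ⊗ P).
  by rewrite whiskerr -(comp2A ax) -cupw_nat (comp2A ax) zigzagl (comp2_1l ax).
by rewrite gE E -gE.
Qed.

End NonDegenerate.

Section Transpose.
Variables (r s : C) (X Y : hom1 r s) (DX : right_dual X) (DY : right_dual Y).
Variable h : hom2 X Y.

(** Transposition with a prefix, written without associators. *)
Lemma transposew (q : C) (W : hom1 q s) :
  id2 W ⊠ transpose DX DY h =
  capw DY (W ⊗ DX) ∘ ((id2 (W ⊗ DX) ⊠ h) ▷ DY) ∘ (cupw DX W ▷ DY).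
Proof.
apply: Cell_inj; rewrite /transpose -[_ ∘ lunV _](comp2A ax) whiskerl.
apply: Cell_comp; last by rewrite !Cell_tens Cell_idtor Cell_lwhisk !cellE.
rewrite whiskerl; apply: Cell_comp; last by rewrite -(tens2_id ax) !cellE.
by rewrite Cell_lwhisk -(tens2_id ax) !cellE.
Qed.

Lemma capw_transpose (q : C) (W : hom1 q r) :
  capw DX W ∘ (id2 (W ⊗ X) ⊠ transpose DX DY h) = capw DY W ∘ ((id2 W ⊠ h) ▷ DY).
Proof.
rewrite transposew -(comp2A ax) (comp2A ax (capw DX W)) -capw_nat.
rewrite -!(comp2A ax) (comp2A ax _ _ (cupw _ _ ▷ _)) -!whiskerr.
by rewrite -slide_whisker -(comp2A ax) zigzagl (comp2_1r ax).
Qed.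

Lemma cupw_transpose (q : C) (W : hom1 q s) :
  ((id2 W ⊠ transpose DX DY h) ▷ Y) ∘ cupw DY W = (id2 (W ⊗ DX) ⊠ h) ∘ cupw DX W.
Proof.
rewrite transposew -(comp2A ax) -whiskerr whiskerr -(comp2A ax) -cupw_nat.
by rewrite (comp2A ax) zigzagl (comp2_1l ax).
Qed.

End Transpose.

Lemma dual_isoE (r s : C) (X : hom1 r s) (D D' : right_dual X) :
  dual_iso D D' = transpose D' D (id2 X).
Proof. by rewrite /transpose !(tens2_id ax) (comp2_1r ax). Qed.

Local Notation rd := (rdual (pivotal C)).
Local Notation io := (iota (pivotal C)).

(** The compatibility of the dagger with the pivotal structure. *)
Lemma capw_dual_dag (q r s : C) (X : hom1 r s) (W : hom1 q r) :
  (capw (rd X) W)^† = ((id2 W ⊠ io X) ▷ rd X) ∘ cupw (rd (rd X)) W.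
Proof.
rewrite lwhisk_dag -left_cupE (lwhisk_comp _ (comp1A W _ _)).
by congr (_ ∘ _); apply: Cell_inj; rewrite Cell_lwhisk !cellE.
Qed.

(** The counterpart of [capw_transpose] for the adjoint caps, that is, for DX as a
left dual. Naturality of iota is what makes the left and the right transpose of h
agree. *)
Lemma capw_dag_transpose (q r s : C) (X Y : hom1 r s) (h : hom2 X Y) (W : hom1 q r) :
  ((id2 W ⊠ h) ▷ rd X) ∘ (capw (rd X) W)^† =
  (id2 (W ⊗ Y) ⊠ transpose (rd X) (rd Y) h) ∘ (capw (rd Y) W)^†.
Proof.
rewrite !capw_dual_dag (comp2A ax) -whiskerr -whiskerl -iota_natural.
rewrite whiskerl whiskerr -(comp2A ax) cupw_transpose !(comp2A ax).
by rewrite slide_whisker.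
Qed.

(** The map mu is the conjugate of tau: the two together carry the cap of X to
the cap of X', and likewise for the adjoint caps. The first condition determines mu
from tau; the second expresses that the identification of the right duals respects
the induced left duals. *)
Definition conj_pair (r s : C) (X X' : hom1 r s) (D : right_dual X)
    (D' : right_dual X') (tau : hom2 X X') (mu : hom2 D D') : Prop :=
  forall (q : C) (W : hom1 q r),
  capw D' W ∘ (id2 (W ⊗ X') ⊠ mu) ∘ ((id2 W ⊠ tau) ▷ D) = capw D W /\
  (id2 (W ⊗ X') ⊠ mu) ∘ ((id2 W ⊠ tau) ▷ D) ∘ (capw D W)^† = (capw D' W)^†.

Section ConjugatePairs.
Variables (r s : C) (X X' : hom1 r s) (D : right_dual X) (D' : right_dual X').
Variables (tau : hom2 X X') (mu : hom2 D D').
Hypotheses (tauU : unitary tau) (cp : conj_pair tau mu).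

(** Let T be the joint action of tau and mu. Both T and T^† respect the caps, so
the cap is unchanged by T^† ∘ T, which is mu^† ∘ mu on the dual factor;
nondegeneracy of the cap makes this the identity. *)
Lemma conj_pair_unitary : unitary mu.
Proof.
have [tU tUV] := tauU; have {}tU : tau^† ∘ tau = id2 _ := tU.
have TT (q : C) (W : hom1 q r) (T := (id2 (W ⊗ X') ⊠ mu) ∘ ((id2 W ⊠ tau) ▷ D)) :
  (T^† ∘ T = id2 (W ⊗ X) ⊠ (mu^† ∘ mu)) * (T ∘ T^† = id2 (W ⊗ X') ⊠ (mu ∘ mu^†)).
  split; rewrite /T; last first.
    rewrite dag_comp (comp2A ax) -(comp2A ax (id2 _ ⊠ mu)) whiskerr_dag -whiskerr.
    rewrite !dag_tens !dag_id -whiskerl tUV !(tens2_id ax) (comp2_1r ax).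
    by rewrite -whiskerl.
  rewrite slide_whisker dag_comp (comp2A ax) -(comp2A ax _ ((id2 W ⊠ tau) ▷ D')^†).
  rewrite whiskerr_dag -whiskerr.
  rewrite !dag_tens !dag_id -whiskerl tU !(tens2_id ax) (comp2_1r ax).
  by rewrite -whiskerl.
have cp' (q : C) (W : hom1 q r) :
    capw D W ∘ ((id2 (W ⊗ X') ⊠ mu) ∘ ((id2 W ⊠ tau) ▷ D))^† = capw D' W.
  by rewrite -[RHS]dagK -(cp W).2 [RHS]dag_comp dagK.
split.
  apply: (capw_injr (D := D)) => W; rewrite (tens2_id ax) (comp2_1r ax).
  by rewrite -(TT _ W).1 (comp2A ax) cp' (comp2A ax) (cp W).1.
apply: (capw_injr (D := D')) => W; rewrite (tens2_id ax) (comp2_1r ax).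
by rewrite -(TT _ W).2 !(comp2A ax) (cp W).1 cp'.
Qed.

Lemma capw_conj (q : C) (W : hom1 q r) :
  capw D' W ∘ (id2 (W ⊗ X') ⊠ mu) = capw D W ∘ ((id2 W ⊠ tau^†) ▷ D).
Proof.
rewrite -(cp W).1 -(comp2A ax _ (_ ▷ D)) -whiskerr -whiskerl.
by rewrite (proj2 tauU) !(tens2_id ax) (comp2_1r ax).
Qed.

Lemma conj_pair_dag : conj_pair tau^† mu^†.
Proof.
have [mU mUV] := conj_pair_unitary; have {}mU : mu^† ∘ mu = id2 _ := mU.
have [tU tUV] := tauU; have {}tU : tau^† ∘ tau = id2 _ := tU.
have E (q : C) (W : hom1 q r) :
   capw D W ∘ (id2 (W ⊗ X) ⊠ mu^†) ∘ ((id2 W ⊠ tau^†) ▷ D') = capw D' W.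
  rewrite -(comp2A ax) slide_whisker (comp2A ax) -capw_conj -(comp2A ax).
  by rewrite -whiskerl mUV (tens2_id ax) (comp2_1r ax).
move=> q W; split; first exact: E.
rewrite -(cp W).2 -!(comp2A ax) (comp2A ax (_ ▷ D')) -slide_whisker.
rewrite -!(comp2A ax) (comp2A ax (_ ▷ D)) -whiskerr -whiskerl tU !(tens2_id ax).
by rewrite (comp2_1l ax) (comp2A ax) -whiskerl mU (tens2_id ax) (comp2_1l ax).
Qed.

(** The cups follow from the caps by a snake. *)
Lemma cupw_conj (q : C) (W : hom1 q s) :
  (id2 (W ⊗ D') ⊠ tau) ∘ ((id2 W ⊠ mu) ▷ X) ∘ cupw D W = cupw D' W.
Proof.
have muE : id2 W ⊠ mu =
    capw D (W ⊗ D') ∘ ((id2 (W ⊗ D') ⊠ tau^†) ▷ D) ∘ (cupw D' W ▷ D).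
  rewrite -capw_conj -(comp2A ax) slide_whisker (comp2A ax) zigzagr.
  by rewrite (comp2_1l ax).
rewrite muE -(comp2A ax (capw D _)) -whiskerr whiskerr -!(comp2A ax) -cupw_nat.
rewrite (comp2A ax (_ ▷ X)) zigzagl (comp2_1l ax) (comp2A ax) -whiskerl.
by rewrite (proj2 tauU) !(tens2_id ax) (comp2_1l ax).
Qed.

End ConjugatePairs.

End Transposition.

(** * Conjugates in a pivotal dagger 2-category *)

Section PivotalDuals.
Variables (K : numClosedFieldType) (C : pivotal_dagger_2category K).
Let ax := lin2catP C.

Local Notation rd := (rdual (pivotal C)).
Local Notation io := (iota (pivotal C)).

Lemma conj_pair_transpose (r s : C) (X X' : hom1 r s) (tau : hom2 X X') :
  unitary tau ->
  conj_pair tau (transpose (rd X') (rd X) tau^† : hom2 (rd X) (rd X')).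
Proof.
case=> [tU tUV] q W; have {}tU : tau^† ∘ tau = id2 _ := tU; split.
  rewrite capw_transpose -(comp2A ax) -whiskerr -whiskerl tU !(tens2_id ax).
  by rewrite (comp2_1r ax).
rewrite slide_whisker -(comp2A ax) -capw_dag_transpose (comp2A ax).
by rewrite -whiskerr -whiskerl tUV !(tens2_id ax) (comp2_1l ax).
Qed.

Lemma conj_pair_trans (r s : C) (X1 X2 X3 : hom1 r s) (D1 : right_dual X1)
    (D2 : right_dual X2) (D3 : right_dual X3) (t : hom2 X1 X2) (t' : hom2 X2 X3)
    (m : hom2 D1 D2) (m' : hom2 D2 D3) :
  conj_pair t m -> conj_pair t' m' -> conj_pair (t' ∘ t) (m' ∘ m).
Proof.
move=> cp cp' q W.
have E : (id2 (W ⊗ X3) ⊠ (m' ∘ m)) ∘ ((id2 W ⊠ (t' ∘ t)) ▷ D1) =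
    ((id2 (W ⊗ X3) ⊠ m') ∘ ((id2 W ⊠ t') ▷ D2)) ∘
    ((id2 (W ⊗ X2) ⊠ m) ∘ ((id2 W ⊠ t) ▷ D1)).
  rewrite !whiskerl whiskerr -!(comp2A ax); congr (_ ∘ _).
  by rewrite !(comp2A ax) slide_whisker.
split; first by rewrite -(comp2A ax) E !(comp2A ax) (cp' _ W).1 (cp _ W).1.
by rewrite E -(comp2A ax) (cp _ W).2 (cp' _ W).2.
Qed.

Section Composite.
Variables (r s t : C) (Y : hom1 r t) (E : hom1 t s).

Lemma Cell_capw_comp (DY : right_dual Y) (DE : right_dual E) (q : C) (W : hom1 q r) :
  Cell (capw (comp_dual DY DE) W) = Cell (capw DY W ∘ (capw DE (W ⊗ Y) ▷ DY)).
Proof.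
rewrite Cell_lwhisk -Cell_tens -[cap (comp_dual _ _)]/(comp_cap DY DE) /comp_cap.
rewrite (whiskerl W) [LHS](Cell_idr (W := W ⊗ (Y ⊗ E ⊗ (DE ⊗ DY)))); last first.
  by rewrite /ascV Cell_tens Cell_idto -Cell_tens (tens2_id ax) comp1A.
rewrite (whiskerl W); apply: Cell_comp; first by rewrite Cell_lwhisk.
by rewrite [RHS]Cell_tens Cell_lwhisk -!(tens2_id ax) !cellE.
Qed.

Lemma Cell_cupw_comp (DY : right_dual Y) (DE : right_dual E) (q : C) (W : hom1 q s) :
  Cell (cupw (comp_dual DY DE) W) = Cell ((cupw DY (W ⊗ DE) ▷ E) ∘ cupw DE W).
Proof.
rewrite Cell_lwhisk -Cell_tens -[cup (comp_dual _ _)]/(comp_cup DY DE) /comp_cup.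
rewrite (whiskerl W); apply: Cell_comp; last by rewrite Cell_lwhisk.
by rewrite [RHS]Cell_tens Cell_lwhisk -!(tens2_id ax) !cellE.
Qed.
End Composite.

(** The canonical map from DE ⊗ DY to D(Y ⊗ E) is the conjugate of the identity.
The condition on caps is the definition of that map. For the adjoint caps, write the
one of D(Y ⊗ E) through iota and expand iota of the composite: the transposes in
the expansion slide through the cups, leaving the adjoint caps of Y and E. *)
Lemma conj_pair_comp_dual (r s t : C) (Y : hom1 r t) (E : hom1 t s)
    (N := comp_dual (rd Y) (rd E)) :
  conj_pair (id2 (Y ⊗ E)) (dual_iso N (rd (Y ⊗ E))).
Proof.
move=> q W; rewrite !(tens2_id ax); split.
  by rewrite (comp2_1r ax) dual_isoE capw_transpose !(tens2_id ax) (comp2_1r ax).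
rewrite (comp2_1r ax) capw_dual_dag.
(* Each canonical map enters only through the way in which it slides along a
   cup. *)
move: (dual_iso N _) (iota_comp (pivotal C) Y E) => k.
set N2 := comp_dual (rd (rd E)) (rd (rd Y)).
set M := rd (rd E ⊗ rd Y).
have := @cupw_transpose _ C _ _ _ _ (rd N) (rd (rd (Y ⊗ E))) k _ W.
move: (transpose _ _ k) => T TE.
have := @cupw_transpose _ C _ _ _ _ N2 M (id2 (rd E ⊗ rd Y)) _ W.
rewrite -dual_isoE; move: (dual_iso M N2) => I IE ioE.
rewrite [io (Y ⊗ E)]ioE !(whiskerl W) !whiskerr -(comp2A ax) TE.
rewrite -(comp2A ax) (comp2A ax _ (id2 _ ⊠ k)) -slide_whisker -(comp2A ax) IE.
rewrite !(tens2_id ax) (comp2_1l ax).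
rewrite (comp2A ax) -slide_whisker -(comp2A ax); congr (_ ∘ _).
apply: Cell_inj; rewrite (Cell_dag (Cell_capw_comp _ _ _)).
rewrite dag_comp whiskerr_dag !capw_dual_dag whiskerr -(comp2A ax).
rewrite (comp2A ax (cupw _ _ ▷ _)) -whiskerr cupw_nat whiskerr -!(comp2A ax).
rewrite (comp2A ax (_ ▷ _ ▷ _) (_ ▷ _ ▷ _ ▷ _)).
apply: Cell_comp; last exact/esym/Cell_cupw_comp.
rewrite -!whiskerr slider [dual_ob N]/(rd E ⊗ rd Y) -(tens2_id ax).
by rewrite !cellE.
Qed.

(** Transpose τ^† to reach D(Y ⊗ E), then use the canonical unitary to
DE ⊗ DY. *)
Lemma exists_conj_pair (r s t : C) (X : hom1 r s) (Y : hom1 r t) (E : hom1 t s)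
    (tau : hom2 X (Y ⊗ E)) : unitary tau ->
  exists mu : hom2 (rd X) (comp_dual (rd Y) (rd E)), conj_pair tau mu.
Proof.
move=> tauU; have cp := conj_pair_transpose tauU.
have idU : unitary (id2 (Y ⊗ E)).
  by split; rewrite /isometry dag_id (comp2_1l ax).
have cp' := conj_pair_dag idU (conj_pair_comp_dual Y E).
exists ((dual_iso (comp_dual (rd Y) (rd E)) (rd (Y ⊗ E)))^†
        ∘ transpose (rd (Y ⊗ E)) (rd X) tau^†).
have := conj_pair_trans cp cp'; rewrite dag_id (comp2_1l ax); exact.
Qed.

Section Nested.
Variables (r s t : C) (X : hom1 r s) (Y : hom1 r t) (E : hom1 t s).
Variables (tau : hom2 X (Y ⊗ E)) (mu : hom2 (rd X) (rd E ⊗ rd Y)).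
Hypothesis tauU : unitary tau.
Hypothesis cp : conj_pair (D := rd X) (D' := comp_dual (rd Y) (rd E)) tau mu.

Lemma nested_capw_dag (q : C) (W : hom1 q r) :
  (W ⊗ Y ⊗ E ◁12 mu) ∘ ((W ◁12 tau) ▷ rd X) ∘ (capw (rd X) W)^†
  = ((capw (rd E) (W ⊗ Y))^† ▷ rd Y) ∘ (capw (rd Y) W)^†.
Proof.
have := Cell_dag (Cell_capw_comp (rd Y) (rd E) W).
rewrite dag_comp whiskerr_dag -(cp W).2 => cE; apply: Cell_inj; rewrite -cE.
apply: Cell_comp => //; apply: Cell_comp; last by rewrite !Cell_tens Cell_lwhisk.
by rewrite Cell_lwhisk -!(tens2_id ax) !cellE.
Qed.

Lemma nested_cupw_dag (q : C) (W : hom1 q s) :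
  (cupw (rd X) W)^† = (cupw (rd E) W)^† ∘ ((cupw (rd Y) (W ⊗ rd E))^† ▷ E)
     ∘ (W ⊗ rd E ⊗ rd Y ◁12 tau) ∘ ((W ◁12 mu) ▷ X).
Proof.
have mU : mu^† ∘ mu = id2 _ := (conj_pair_unitary tauU cp).1.
have tU : tau^† ∘ tau = id2 _ := tauU.1.
have : (cupw (rd X) W)^† = (cupw (comp_dual (rd Y) (rd E)) W)^† ∘
   (id2 (W ⊗ (rd E ⊗ rd Y)) ⊠ tau) ∘ ((id2 W ⊠ mu) ▷ X).
  rewrite -(cupw_conj tauU cp W) !dag_comp -!(comp2A ax).
  rewrite (comp2A ax (id2 _ ⊠ tau)^†) !dag_tens !dag_id -whiskerl.
  rewrite tU !(tens2_id ax) (comp2_1l ax).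
  rewrite -whiskerr -whiskerl.
  by rewrite mU !(tens2_id ax) (comp2_1r ax).
move->; apply: Cell_inj; apply: Cell_comp; last by rewrite !Cell_tens Cell_lwhisk.
apply: Cell_comp; last by rewrite Cell_lwhisk -!(tens2_id ax) !cellE.
by rewrite (Cell_dag (Cell_cupw_comp _ _ _)) dag_comp whiskerr_dag.
Qed.

End Nested.
End PivotalDuals.

(** * The cap of a dagger equivalence *)

Section Scalars.
Variables (K : numClosedFieldType) (C : pivotal_dagger_2category K).
Let ax := lin2catP C.

Local Notation rd := (rdual (pivotal C)).

Definition scalar_end (r s : C) (P : hom1 r s) : Prop :=
  forall h : hom2 P P, exists k : K, h = k *: id2 P.

Lemma comp0l (r s : C) (X Y Z : hom1 r s) (f : hom2 X Y) : (0 : hom2 Y Z) ∘ f = 0.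
Proof. by rewrite -(scale0r (0 : hom2 Y Z)) comp2Zl scale0r. Qed.

Lemma comp0r (r s : C) (X Y Z : hom1 r s) (g : hom2 Y Z) : g ∘ (0 : hom2 X Y) = 0.
Proof. by rewrite -(scale0r (0 : hom2 X Y)) comp2Zr scale0r. Qed.

Lemma tens0l (r s t : C) (X X' : hom1 r s) (Y Y' : hom1 s t) (g : hom2 Y Y') :
  (0 : hom2 X X') ⊠ g = 0.
Proof. by rewrite -(scale0r (0 : hom2 X X')) tens2Zl scale0r. Qed.

Lemma tens0r (r s t : C) (X X' : hom1 r s) (Y Y' : hom1 s t) (g : hom2 X X') :
  g ⊠ (0 : hom2 Y Y') = 0.
Proof. by rewrite -(scale0r (0 : hom2 Y Y')) tens2Zr scale0r. Qed.

Lemma id_neq0_simple (r : C) : simple_ob r -> id2 (id1 r) != 0.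
Proof.
case=> f [g _ gK]; apply/eqP => id0.
have := gK 1; rewrite -[g 1](comp2_1l ax) id0 comp0l linear0.
by move/esym/eqP; rewrite (negPf (oner_neq0 _)).
Qed.

Lemma scalar_end_simple (r : C) : simple_ob r -> scalar_end (id1 r).
Proof.
move=> r_simple h; have := id_neq0_simple r_simple.
case: r_simple => f /bij_inj finj id_neq0.
have fid : f (id2 (id1 r)) != 0.
  by apply: contra_neq id_neq0 => f0; apply: finj; rewrite f0 linear0.
exists (f h / f (id2 (id1 r))); apply: finj.
by rewrite linearZ /= [_ *: _]mulfVK.
Qed.

Lemma scalar_end_iso (r s : C) (P Q : hom1 r s) (u : hom2 P Q) (v : hom2 Q P) :
  u ∘ v = id2 Q -> scalar_end P -> scalar_end Q.
Proof.
move=> uv sP h; have [k hk] := sP (v ∘ h ∘ u); exists k.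
have -> : h = u ∘ (v ∘ h ∘ u) ∘ v.
  by rewrite !(comp2A ax) uv (comp2_1l ax) -(comp2A ax) uv (comp2_1r ax).
by rewrite hk comp2Zr (comp2_1r ax) comp2Zl uv.
Qed.

Lemma lwhisk_unit_inj (r s : C) (V : hom1 r r) (u : hom2 (id1 r) V) (v : hom2 V (id1 r))
    (P Q : hom1 r s) (h h' : hom2 P Q) :
  v ∘ u = id2 _ -> id2 V ⊠ h = id2 V ⊠ h' -> h = h'.
Proof.
move=> vu E; apply: lwhisk1_inj; rewrite -!vu.
have gE (g : hom2 P Q) : (v ∘ u) ⊠ g = (v ▷ Q) ∘ (id2 V ⊠ g) ∘ (u ▷ P).
  by rewrite -!(interchange ax) (comp2_1r ax) (comp2_1l ax) (comp2_1r ax).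
by rewrite !gE E.
Qed.

Lemma rwhisk_unit_inj (r s : C) (V : hom1 s s) (u : hom2 (id1 s) V) (v : hom2 V (id1 s))
    (P Q : hom1 r s) (h h' : hom2 P Q) :
  v ∘ u = id2 _ -> h ▷ V = h' ▷ V -> h = h'.
Proof.
move=> vu E; apply: Cell_inj.
rewrite -[Cell h]ctens1r -[Cell h']ctens1r -!Cell_tens -!vu.
have gE (g : hom2 P Q) : g ⊠ (v ∘ u) = (id2 Q ⊠ v) ∘ (g ▷ V) ∘ (id2 P ⊠ u).
  by rewrite -!(interchange ax) (comp2_1r ax) (comp2_1l ax) (comp2_1r ax).
by rewrite !gE E.
Qed.

Section Equivalence.
Variables (s t : C) (E : hom1 t s) (E' : hom1 s t).
Variables (a : hom2 (id1 s) (E' ⊗ E)) (b : hom2 (E ⊗ E') (id1 t)).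
Hypotheses (aU : unitary a) (bU : unitary b) (t_simple : simple_ob t).

Let aU1 : a^† ∘ a = id2 _ := aU.1.

(** The faithful functor of tensoring with E' embeds the endomorphisms of E in
those of E ⊗ E', and E ⊗ E' is isomorphic to the identity of the simple object t. *)
Lemma scalar_end_equiv : scalar_end E.
Proof.
have sEE' : scalar_end (E ⊗ E').
  apply: (scalar_end_iso (u := b^†) (v := b)); first exact: bU.1.
  exact: scalar_end_simple.
move=> h; have [k hk] := sEE' (h ▷ E'); exists k.
apply: (rwhisk_unit_inj aU1); rewrite tens2Zl (tens2_id ax); apply: Cell_inj.
transitivity (Cell ((h ▷ E') ▷ E)); first by rewrite -(tens2_id ax) !cellE.
rewrite hk tens2Zl; apply: Cell_scale.
by rewrite !(tens2_id ax); apply: Cell_id; rewrite comp1A.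
Qed.

(** The transpose of an endomorphism of DE is an endomorphism of DDE, which is
isomorphic to E by iota; an endomorphism with scalar transpose is a scalar. *)
Lemma scalar_end_rd : scalar_end (rd E : hom1 _ _).
Proof.
have sDD : scalar_end (rd (rd E) : hom1 _ _).
  apply: (scalar_end_iso (u := iotaV (pivotal C) E)) scalar_end_equiv.
  exact: iotaK.
move=> h; have [k hk] := sDD (transpose (rd (rd E)) (rd (rd E)) h); exists k.
apply: (capw_injl (D := rd (rd E))) => W.
rewrite -(capw_transpose (rd (rd E)) (rd (rd E))) hk.
by rewrite !tens2Zr tens2Zl !(tens2_id ax).
Qed.

(** Tensoring with E' on the left is faithful and sends E ⊗ DE to a copy of
DE. *)
Lemma scalar_end_counit : scalar_end (E ⊗ rd E).
Proof.
have sc : scalar_end (E' ⊗ (E ⊗ rd E)).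
  apply: (scalar_end_iso (u := ascV E' E (rd E) ∘ (a ▷ rd E) ∘ lunV (rd E))
    (v := lun (rd E) ∘ (a^† ▷ rd E) ∘ asc E' E (rd E))) scalar_end_rd.
  rewrite !(comp2A ax).
  have -> : ascV E' E (rd E) ∘ (a ▷ rd E) ∘ lunV (rd E) ∘ lun (rd E) =
     ascV E' E (rd E) ∘ (a ▷ rd E).
    by apply: Cell_inj; rewrite !Cell_idtor.
  rewrite -(comp2A ax _ (a ▷ _)) -whiskerr aU.2 (tens2_id ax) (comp2_1r ax).
  exact: ascV_asc.
move=> h; have [k hk] := sc (id2 E' ⊠ h); exists k.
apply: (lwhisk_unit_inj (V := E ⊗ E') (u := b^†) (v := b)); first exact: bU.2.
rewrite tens2Zr (tens2_id ax); apply: Cell_inj.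
transitivity (Cell (id2 E ⊠ (id2 E' ⊠ h))); first by rewrite -(tens2_id ax) !cellE.
rewrite hk tens2Zr; apply: Cell_scale.
by rewrite !(tens2_id ax); apply: Cell_id; rewrite comp1A.
Qed.

Lemma scale_id_inj (k k' : K) :
  k *: id2 (id1 t ⊗ E) = k' *: id2 (id1 t ⊗ E) -> k = k'.
Proof.
have Eid : id2 (id1 t ⊗ E) != 0.
  apply: contra_neq (id_neq0_simple t_simple) => id0.
  have E0 : id2 E = 0 by apply: lwhisk1_inj; rewrite tens0r (tens2_id ax).
  by rewrite -bU.2 -[b](comp2_1r ax) -(tens2_id ax) E0 tens0l comp0r comp0l.
move/eqP; rewrite -subr_eq0 -scalerBl scaler_eq0 (negPf Eid) orbF subr_eq0.
by move/eqP.
Qed.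

Variable d : K.
Hypothesis d_neq0 : d != 0.
Hypothesis dimE : forall (q : C) (W : hom1 q s),
  (cupw (rd E) W)^† ∘ cupw (rd E) W = d *: id2 W.

(** The composite is a scalar k by [scalar_end_counit]. Multiplying a snake
equation by its dagger produces a loop of dimension d and this composite, so
k * d = 1. *)
Lemma capw_dag_capw (q : C) (W : hom1 q t) :
  (capw (rd E) W)^† ∘ capw (rd E) W = d^-1 *: id2 _.
Proof.
have [k kE] := scalar_end_counit ((cap (rd E))^† ∘ cap (rd E)).
have kw (p : C) (V : hom1 p t) : (capw (rd E) V)^† ∘ capw (rd E) V = k *: id2 _.
  by rewrite lwhisk_dag -lwhisk_comp kE lwhiskZ lwhisk_id.
suff kd : k * d = 1 by rewrite kw -[k](mulfK d_neq0) kd mul1r.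
apply: scale_id_inj; rewrite scale1r.
have zz := zigzagl (rd E) (id1 t).
have zzd := congr1 (@dag _ _ _ _ _ _) zz.
rewrite dag_comp dag_id whiskerr_dag in zzd.
rewrite -[RHS](comp2_1l ax) -[X in X ∘ _]zzd -[X in _ ∘ X]zz.
rewrite (comp2A ax) -(comp2A ax _ ((capw _ _)^† ▷ E)) -whiskerr kw tens2Zl (tens2_id ax).
by rewrite comp2Zr (comp2_1r ax) comp2Zl dimE scalerA.
Qed.

(** This composite is a scalar too, since t is simple. Both scalars arise from
cap ∘ cap^† ∘ cap, hence they agree. *)
Lemma capw_capw_dag (q : C) (W : hom1 q t) :
  capw (rd E) W ∘ (capw (rd E) W)^† = d^-1 *: id2 W.
Proof.
have [k kE] := scalar_end_simple t_simple (cap (rd E) ∘ (cap (rd E))^†).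
have kw (p : C) (V : hom1 p t) : capw (rd E) V ∘ (capw (rd E) V)^† = k *: id2 _.
  by rewrite lwhisk_dag -lwhisk_comp kE lwhiskZ lwhisk_id.
rewrite kw; congr (_ *: _); apply: scale_id_inj.
have zz := zigzagl (rd E) (id1 t); rewrite -zz -!comp2Zl -!tens2Zl.
congr (_ ▷ _ ∘ _); rewrite -[X in k *: X](comp2_1l ax) -comp2Zl -kw -(comp2A ax).
by rewrite capw_dag_capw comp2Zr (comp2_1r ax).
Qed.

(** In the adjoint snake equation the adjoint cap is d^-1 times the inverse of the
cap. *)
Lemma cupw_dagE (q : C) (W : hom1 q t) :
  (cupw (rd E) (W ⊗ E))^† = d *: (capw (rd E) W ▷ E).
Proof.
have zz := congr1 (@dag _ _ _ _ _ _) (zigzagl (rd E) W).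
rewrite dag_comp dag_id whiskerr_dag in zz.
rewrite -[X in d *: X](comp2_1l ax) -zz -(comp2A ax) -whiskerr capw_dag_capw.
by rewrite tens2Zl (tens2_id ax) comp2Zr (comp2_1r ax) scalerA mulfV // scale1r.
Qed.

End Equivalence.
End Scalars.

(** * From an equivalence to a unitary monoid isomorphism *)

Section IsomorphismFromEquivalence.
Variables (K : numClosedFieldType) (C : pivotal_dagger_2category K).
Let ax := lin2catP C.

Section Data.
Variables (r s t : C) (t_simple : simple_ob t).
Variables (X : hom1 r s) (Y : hom1 r t) (dX dY : K).
Hypotheses (dX_gt0 : 0 < dX) (dY_gt0 : 0 < dY).
Hypotheses (dimX : dimL X = dX *: id2 (id1 s)) (dimY : dimL Y = dY *: id2 (id1 t)).
Variables (E : hom1 t s) (E' : hom1 s t).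
Variables (a : hom2 (id1 s) (E' ⊗ E)) (b : hom2 (E ⊗ E') (id1 t)).
Hypotheses (aU : unitary a) (bU : unitary b).
Local Notation DX := (rdual (pivotal C) X).
Local Notation DY := (rdual (pivotal C) Y).
Local Notation DE := (rdual (pivotal C) E).
Variables (tau : hom2 X (Y ⊗ E)) (mu : hom2 DX (DE ⊗ DY)).
Hypothesis tauU : unitary tau.
Hypothesis cp : conj_pair (D := DX) (D' := comp_dual DY DE) tau mu.

Let muU : unitary mu := conj_pair_unitary tauU cp.

(** A loop of X is carried by the unitaries τ and μ to a loop of Y inside a loop
of E, so dX = dY dim_L(E). *)
Lemma dim_equivalence (q : C) (W : hom1 q s) :
  (cupw DE W)^† ∘ cupw DE W = (dX / dY) *: id2 W.
Proof.
pose U := (W ⊗ DE ⊗ DY ◁12 tau) ∘ ((W ◁12 mu) ▷ X).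
have UU : U ∘ U^† = id2 _.
  by apply: (unitary_comp _ _).2; [|apply: whiskerr_unitary]; apply: lwhisk_unitary.
pose P := (cupw DE W)^† ∘ ((cupw DY (W ⊗ DE))^† ▷ E).
have PE : (cupw DX W)^† = P ∘ U by rewrite (nested_cupw_dag tauU cp) -(comp2A ax).
have PP : P ∘ P^† = dX *: id2 W.
  rewrite -(cupw_dim dimX W) -[X in _ = _ ∘ X]dagK PE.
  by rewrite [(P ∘ U)^†]dag_comp (comp2A ax) -(comp2A ax P) UU (comp2_1r ax).
rewrite /P dag_comp dagK whiskerr_dag dagK (comp2A ax) in PP.
rewrite -(comp2A ax (cupw DE W)^†) -whiskerr (cupw_dim dimY) in PP.
rewrite tens2Zl (tens2_id ax) comp2Zr (comp2_1r ax) comp2Zl in PP.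
by rewrite mulrC -scalerA -PP scalerA mulVf ?scale1r ?gt_eqF.
Qed.

Let dE_neq0 : dX / dY != 0.
Proof. by rewrite mulf_neq0 ?invr_eq0 ?gt_eqF. Qed.

Let c := sqrtC dX / sqrtC dY.
Let T : hom2 (X ⊗ DX) (Y ⊗ E ⊗ DE ⊗ DY) := (Y ⊗ E ◁12 mu) ∘ (tau ▷ DX).

(** The factor c is the square root of dim_L(E); it makes the cap of E unitary. *)
Definition contraction : hom2 (X ⊗ DX) (Y ⊗ DY) := c *: ((capw DE Y ▷ DY) ∘ T).

Let c2 : c * c = dX / dY.
Proof. by rewrite /c mulf_div -!expr2 !sqrtCK. Qed.

Let cJ : c^* = c.
Proof. by rewrite geC0_conj // divr_ge0 // sqrtC_ge0 ltW. Qed.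

Let TU : unitary T.
Proof.
by apply: unitary_comp; [apply: lwhisk_unitary|apply: whiskerr_unitary].
Qed.

Let capE1 := capw_dag_capw aU bU t_simple dE_neq0 dim_equivalence.
Let capE2 := capw_capw_dag aU bU t_simple dE_neq0 dim_equivalence.
Let cupE := cupw_dagE aU bU t_simple dE_neq0 dim_equivalence.

Lemma contraction_unitary : unitary contraction.
Proof.
have -> : contraction = ((c *: capw DE Y) ▷ DY) ∘ T.
  by rewrite tens2Zl comp2Zl.
apply: unitary_comp => //; apply: whiskerr_unitary.
rewrite /unitary /isometry dagZ cJ !comp2Zl !comp2Zr capE1 capE2.
by rewrite !scalerA c2 mulfV // !scale1r.
Qed.

(** Both sides are reduced to the same normal form: apply τ and μ to all four
factors, contract the three adjacent pairs, two E ⊗ DE and one DY ⊗ Y. On the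
left the adjoint cup of X in the middle is first replaced by the adjoint cups of Y
and E, and then that of E by a cap. *)
Lemma contraction_mul :
  contraction ∘ pair_mul X dX = pair_mul Y dY ∘ (contraction ⊠ contraction).
Proof.
apply/nested_multP => //.
have c_inv : sqrtC dY / sqrtC dX * c = 1.
  by rewrite /c mulf_div [sqrtC dY * _]mulrC mulfV // mulf_neq0 ?sqrtC_eq0 ?gt_eqF.
rewrite comp2Zl scalerA c_inv scale1r.
have TX : T ∘ ((cupw DX X)^† ▷ DX) =
    (Y ⊗ E ◁12 mu) ∘ ((cupw DX (Y ⊗ E))^† ▷ DX) ∘ (tau ▷ DX ▷ X ▷ DX).
  by rewrite -!(comp2A ax) -!whiskerr cupw_dag_nat.
rewrite -(comp2A ax (capw DE Y ▷ DY)) TX.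
(* [S] is the common normal form and [R] its lower part. *)
pose R := ((Y ⊗ E ⊗ DE ⊗ DY ◁12 tau) ▷ DX) ∘ (T ▷ X ▷ DX).
pose V := Y ⊗ E ⊗ DE ⊗ DY ⊗ Y ⊗ E.
pose S := (((cupw DY Y)^† ∘ capw DE (Y ⊗ DY ⊗ Y)) ▷ DY)
  ∘ (capw DE Y ▷ DY ▷ Y ▷ E ▷ DE ▷ DY) ∘ (V ◁12 mu) ∘ R.
have LE : (Y ⊗ E ◁12 mu) ∘ ((cupw DX (Y ⊗ E))^† ▷ DX) ∘ (tau ▷ DX ▷ X ▷ DX)
    = (dX / dY) *: ((Y ⊗ E ◁12 mu) ∘ (capw DE Y ▷ E ▷ DX)
        ∘ ((cupw DY (Y ⊗ E ⊗ DE))^† ▷ E ▷ DX) ∘ R).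
  rewrite (nested_cupw_dag tauU cp) cupE /R /T !whiskerr !tens2Zl.
  by rewrite !(comp2Zl, comp2Zr) !(comp2A ax).
have nat1 := lwhisk12_nat mu (capw DE Y ▷ E).
have nat2 := lwhisk12_nat mu ((cupw DY (Y ⊗ E ⊗ DE))^† ▷ E).
have nat3 := cupw_dag_nat DY (capw DE Y).
have nat4 := capw_nat DE (cupw DY Y)^†.
have key : capw DE Y ∘ (capw DE Y ▷ E ▷ DE) ∘ ((cupw DY (Y ⊗ E ⊗ DE))^† ▷ E ▷ DE)
    = (cupw DY Y)^† ∘ capw DE (Y ⊗ DY ⊗ Y) ∘ (capw DE Y ▷ DY ▷ Y ▷ E ▷ DE).
  by rewrite -nat4 -!(comp2A ax) -!whiskerr nat3.
transitivity ((dX / dY) *: S).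
  rewrite LE comp2Zr; congr (_ *: _); rewrite /S.
  rewrite nat1 -(comp2A ax _ _ (_ ▷ E ▷ DX)) nat2 !(comp2A ax) -!whiskerr.
  by rewrite key.
have fN : (Y ⊗ DY ◁22 contraction) = c *: ((capw DE (Y ⊗ DY ⊗ Y) ▷ DY)
    ∘ (Y ⊗ DY ⊗ Y ⊗ E ◁12 mu) ∘ ((Y ⊗ DY ◁12 tau) ▷ DX)).
  rewrite lwhiskZ; congr (_ *: _); apply: Cell_inj; rewrite Cell_lwhisk -Cell_tens.
  rewrite /T (comp2A ax) !(whiskerl (Y ⊗ DY)).
  apply: Cell_comp; last by rewrite !Cell_tens Cell_lwhisk !cellE.
  apply: Cell_comp; rewrite ?Cell_tens ?Cell_lwhisk -?(tens2_id ax);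
    by rewrite ?cellE ?Cell_lwhisk ?cellE.
rewrite fN /contraction !tens2Zl !(comp2Zl, comp2Zr) scalerA c2; congr (_ *: _).
rewrite /S /R !whiskerr.
have nat5 : ((Y ⊗ DY ◁12 tau) ▷ DX) ∘ (capw DE Y ▷ DY ▷ X ▷ DX)
    = (capw DE Y ▷ DY ▷ Y ▷ E ▷ DX) ∘ ((Y ⊗ E ⊗ DE ⊗ DY ◁12 tau) ▷ DX).
  by rewrite -!whiskerr lwhisk12_nat.
have nat6 := lwhisk12_nat mu (capw DE Y ▷ DY ▷ Y ▷ E).
rewrite /chosen_dual !(comp2A ax) -(comp2A ax _ _ (capw DE Y ▷ DY ▷ X ▷ DX)) nat5.
rewrite !(comp2A ax) -(comp2A ax _ _ (capw DE Y ▷ DY ▷ Y ▷ E ▷ DX)) nat6.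
by rewrite !(comp2A ax).
Qed.

Lemma contraction_unit : contraction ∘ pair_unit X dX = pair_unit Y dY.
Proof.
have TE : T ∘ (cap DX)^† = ((capw DE Y)^† ▷ DY) ∘ (cap DY)^†.
  have E1 := congr1 (@Cell _ _ _ _ _ _) (nested_capw_dag cp (id1 r)).
  apply: Cell_inj; transitivity (Cell ((id1 r ⊗ Y ⊗ E ◁12 mu)
      ∘ ((id1 r ◁12 tau) ▷ DX) ∘ (capw DX (id1 r))^†)).
    apply: Cell_comp; last by rewrite lwhisk_dag Cell_lwhisk ctens1l.
    apply: Cell_comp; last by rewrite !Cell_tens !Cell_lwhisk ctens1l.
    by rewrite !Cell_lwhisk -!(tens2_id ax) !cellE.
  rewrite E1; apply: Cell_comp; last by rewrite lwhisk_dag Cell_lwhisk ctens1l.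
  by rewrite !Cell_tens !lwhisk_dag !Cell_lwhisk -!(tens2_id ax) !cellE.
rewrite /pair_unit comp2Zr comp2Zl -(comp2A ax) TE (comp2A ax) -whiskerr capE2.
rewrite tens2Zl (tens2_id ax) comp2Zl (comp2_1l ax) !scalerA; congr (_ *: _).
have sX : sqrtC dX != 0 by rewrite sqrtC_eq0 gt_eqF.
have c_neq0 : c != 0 by rewrite mulf_neq0 ?invr_eq0 ?sqrtC_eq0 ?gt_eqF.
by rewrite -c2 invfM mulrA mulfK // /c invf_div mulrC divfK.
Qed.

Lemma contraction_star :
  unitarily_star_isomorphic (pair_monoid dX_gt0 dimX) (pair_monoid dY_gt0 dimY).
Proof.
exists contraction; split; first exact: contraction_unitary.
apply: star_homomorphism_of_unitary.
- exact: contraction_unitary.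
- exact: contraction_mul.
- exact: contraction_unit.
Qed.

End Data.

Lemma star_iso_of_equivalent (r s t : C) (t_simple : simple_ob t)
  (X : hom1 r s) (Y : hom1 r t) (dX dY : K)
  (dX_gt0 : 0 < dX) (dY_gt0 : 0 < dY)
  (dimX : dimL X = dX *: id2 (id1 s)) (dimY : dimL Y = dY *: id2 (id1 t)) :
  equivalent X Y ->
  unitarily_star_isomorphic (pair_monoid dX_gt0 dimX) (pair_monoid dY_gt0 dimY).
Proof.
case=> E [tau [[E' [a [b [aU bU]]]] tauU]].
have [mu cp] := exists_conj_pair tauU.
exact: (contraction_star t_simple dX_gt0 dY_gt0 dimX dimY aU bU tauU cp).
Qed.
End IsomorphismFromEquivalence.

Theorem theorem5p7 (R : realType) (C : pivotal_dagger_2category R[i])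
  (split : split_dagger_idempotents C)
  (r s t : C) (s_simple : simple_ob s) (t_simple : simple_ob t)
  (X : hom1 r s) (Y : hom1 r t) (dX dY : R[i])
  (dX_gt0 : 0 < dX) (dY_gt0 : 0 < dY)
  (dimX : dimL X = dX *: id2 (id1 s)) (dimY : dimL Y = dY *: id2 (id1 t)) :
  equivalent X Y <->
  unitarily_star_isomorphic (pair_monoid dX_gt0 dimX) (pair_monoid dY_gt0 dimY).
Proof.
split; first exact: star_iso_of_equivalent.
exact: equivalent_of_star_iso.
Qed.
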